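(* Let $m,n\ge1$, let $A_1,\dots,A_m$ be $n\times n$ complex matrices, let $Q$ be an $n\times n$ Hermitian positive definite matrix, and let $X$ be the (unique) Hermitian positive definite solution of $X-\sum_{i=1}^mA_i^*X^{-1}A_i=Q$. Let $\xi,\rho,\eta_1,\dots,\eta_m$ be positive real parameters and let $c(X)$ be the condition number $$c(X)=\lim_{\delta\to0^+}\ \sup_{\left\|\left(\frac{\Delta A_1}{\eta_1},\dots,\frac{\Delta A_m}{\eta_m},\frac{\Delta Q}{\rho}\right)\right\|_F\le\delta}\frac{\|\Delta X\|_F}{\xi\delta},$$ where $\Delta A_i$ ranges over $n\times n$ complex matrices, $\Delta Q$ over $n\times n$ Hermitian matrices, and $\Delta X=\widetilde X-X$ with $\widetilde X$ the Hermitian positive definite solution of the equation with $A_i,Q$ replaced by $A_i+\Delta A_i,Q+\Delta Q$. Then $$c(X)=\frac1\xi\left\|\left(\rho S_c,\ \eta_1U_1,\ \eta_2U_2,\ \dots,\ \eta_mU_m\right)\right\|,$$ where $S_c$ and $U_i$ are the real $2n^2\times 2n^2$ matrices defined in the context.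
   Context: $\|\cdot\|$ is the spectral norm, $\|\cdot\|_F$ the Frobenius norm, $\mathbf i$ the imaginary unit, $A^*$ the conjugate transpose, and $(M_1,\dots,M_k)$ denotes the block row matrix. For every choice of $n\times n$ complex $A_i$ and Hermitian positive definite $Q$, the equation $X-\sum_{i=1}^m A_i^*X^{-1}A_i=Q$ has exactly one Hermitian positive definite solution; for $\delta$ small, $Q+\Delta Q$ is positive definite, so $\widetilde X$ is well defined. For $A=(a_1,\dots,a_n)$ with columns $a_j$, $\mathrm{vec}\,A=(a_1^T,\dots,a_n^T)^T$; $A\otimes B=(a_{ij}B)$ is the Kronecker product; $\Pi$ is the $n^2\times n^2$ vec-permutation matrix, with $\mathrm{vec}\,E^T=\Pi\,\mathrm{vec}\,E$ for all $n\times n$ matrices $E$. Put $B_i=X^{-1}A_i$ and $L=I\otimes I+\sum_{i=1}^mB_i^T\otimes B_i^*$, which is an invertible $n^2\times n^2$ matrix. Define real $n^2\times n^2$ matrices $S,\Sigma,U_{i1},\Omega_{i1},U_{i2},\Omega_{i2}$ by splitting into real and imaginary parts $$L^{-1}=S+\mathbf i\Sigma,\qquad L^{-1}(I\otimes B_i^* )=U_{i1}+\mathbf i\Omega_{i1},\qquad L^{-1}(B_i^T\otimes I)\Pi=U_{i2}+\mathbf i\Omega_{i2},$$ and set $$S_c=\begin{bmatrix}S&-\Sigma\\ \Sigma&S\end{bmatrix},\qquad U_i=\begin{bmatrix}U_{i1}+U_{i2}&\Omega_{i2}-\Omega_{i1}\\ \Omega_{i1}+\Omega_{i2}&U_{i1}-U_{i2}\end{bmatrix},\quad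 i=1,\dots,m.$$ *)

(* Defs.v *)
From HB Require Import structures.
From mathcomp Require Import all_boot all_order all_algebra.
From mathcomp Require Import all_classical all_reals all_analysis.
From mathcomp Require Import complex mxtens.

Set Implicit Arguments.
Unset Strict Implicit.
Unset Printing Implicit Defensive.

Import Order.TTheory GRing.Theory Num.Theory.
Import numFieldNormedType.Exports.

Local Open Scope classical_set_scope.
Local Open Scope sesquilinear_scope.
Local Open Scope ring_scope.

Section Vec.
Variable K : comNzRingType.

(* [tensmx] numbers the pair (i, j) as i * n + j, so the entries of [vec A] are
   the columns of A, one after the other. *)
Definition vec m n (A : 'M[K]_(m, n)) : 'cV[K]_(n * m) :=
  \col_k A (mxtens_unindex k).2 (mxtens_unindex k).1.

Definition vec_perm_mx n : 'M[K]_(n * n) :=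
  \matrix_(k, l) (mxtens_unindex k == ((mxtens_unindex l).2, (mxtens_unindex l).1))%:R.

Lemma vec_trmx n (E : 'M[K]_n) : vec E^T = vec_perm_mx n *m vec E.
Proof.
apply/colP => k; case: (mxtens_indexP k) => i j.
rewrite [RHS]mxE (bigD1 (mxtens_index (j, i))) //= !mxE !mxtens_indexK eqxx mul1r.
rewrite big1 ?addr0 // => l; case: (mxtens_indexP l) => a b nab.
rewrite !mxE !mxtens_indexK; case: eqP => [[ib ja]|]; last by rewrite mul0r.
by case/eqP: nab; rewrite ib ja.
Qed.

Lemma vec_mulmx m n p q (A : 'M[K]_(m, n)) (E : 'M[K]_(n, p)) (B : 'M[K]_(p, q)) :
  vec (A *m E *m B) = (B^T *t A) *m vec E.
Proof.
apply/colP => k; rewrite !mxE.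
under eq_bigr do rewrite mxE big_distrl /=.
rewrite pair_big (reindex (@mxtens_unindex p n)) /=; last first.
  by exists (@mxtens_index p n) => i _; rewrite ?mxtens_indexK ?mxtens_unindexK.
by apply: eq_bigr => l _; rewrite !mxE mulrAC [X in X * _]mulrC.
Qed.

End Vec.

Section Norms.
Variable R : realType.

Definition frobenius_norm m n (A : 'M[R[i]]_(m, n)) : R :=
  Num.sqrt (\sum_i \sum_j Normc.normc (A i j) ^+ 2).

Definition euclidean_norm n (x : 'cV[R]_n) : R :=
  Num.sqrt (\sum_i x i 0 ^+ 2).

Definition spectral_norm m n (M : 'M[R]_(m, n)) : R :=
  sup [set euclidean_norm (M *m x) | x in [set x | euclidean_norm x <= 1]].

End Norms.

Section Equation.
Variables (R : realType) (m n : nat).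
Implicit Types (A dA : 'I_m -> 'M[R[i]]_n) (X Q dQ : 'M[R[i]]_n).
Implicit Types (xi rho delta : R) (eta : 'I_m -> R).

(* In the order of R[i], 0 < z means that z is real and positive. *)
Definition hermitian_posdef X :=
  X \is hermsymmx /\
  forall x : 'cV[R[i]]_n, x != 0 -> 0 < (x^t* *m X *m x) 0 0.

Definition is_hpd_solution A Q X :=
  hermitian_posdef X /\
  X - \sum_(i < m) (A i)^t* *m invmx X *m A i = Q.

Definition scaled_perturbation eta rho dA dQ : 'M[R[i]]_(n, \sum_(i < m) n + n) :=
  row_mx (\mxrow_(i < m) ((eta i)^-1%:C%C *: dA i)) (rho^-1%:C%C *: dQ).

(* The perturbed equation has exactly one Hermitian positive definite solution
   [Xt] as soon as Q + dQ is positive definite, hence for all the perturbations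
   considered once [delta] is small; the supremum is taken in the extended
   reals, so that no boundedness is presupposed. *)
Definition worst_relative_change A Q X xi rho eta delta : \bar R :=
  ereal_sup [set y | exists dA dQ Xt,
    [/\ dQ \is hermsymmx,
        frobenius_norm (scaled_perturbation eta rho dA dQ) <= delta,
        is_hpd_solution (fun i => A i + dA i) (Q + dQ) Xt
      & y = (frobenius_norm (Xt - X) / (xi * delta))%:E]].

Definition Bmx A X (i : 'I_m) : 'M[R[i]]_n := invmx X *m A i.

Definition Lmx A X : 'M[R[i]]_(n * n) :=
  1%:M *t 1%:M + \sum_(i < m) (Bmx A X i)^T *t (Bmx A X i)^t*.

Definition Remx p q (M : 'M[R[i]]_(p, q)) : 'M[R]_(p, q) := map_mx (@complex.Re R) M.
Definition Immx p q (M : 'M[R[i]]_(p, q)) : 'M[R]_(p, q) := map_mx (@complex.Im R) M.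

Definition Scmx A X : 'M[R]_(n * n + n * n) :=
  let S := Remx (invmx (Lmx A X)) in
  let Sigma := Immx (invmx (Lmx A X)) in
  block_mx S (- Sigma) Sigma S.

Definition Umx A X (i : 'I_m) : 'M[R]_(n * n + n * n) :=
  let M1 := invmx (Lmx A X) *m (1%:M *t (Bmx A X i)^t*) in
  let M2 := invmx (Lmx A X) *m ((Bmx A X i)^T *t 1%:M) *m vec_perm_mx _ n in
  let U1 := Remx M1 in let Omega1 := Immx M1 in
  let U2 := Remx M2 in let Omega2 := Immx M2 in
  block_mx (U1 + U2) (Omega2 - Omega1) (Omega1 + Omega2) (U1 - U2).

End Equation.

(* Main.v *)
Require Import Defs.
From mathcomp Require Import all_boot all_order all_algebra.
From mathcomp Require Import all_classical all_reals all_analysis.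
From mathcomp Require Import complex mxtens ring lra.
Import Order.TTheory GRing.Theory Num.Theory.
Import numFieldNormedType.Exports.
Local Open Scope classical_set_scope.
Local Open Scope ring_scope.

(** Write [V = X^-1], [B_i = V A_i] and [Lambda D = D + sum_i B_i^* D B_i].  The residual
    [X - sum_i A_i^* X^-1 A_i] expands exactly as
    [dQ = Lambda dX - sum_i (dA_i^* B_i + B_i^* dA_i) + remainder], where the remainder is
    quadratic in [(dA, dX)] once [(X + dX)^-1] is bounded.

    Upper bound.  Every perturbed solution [Y] satisfies [Y >= Q + dQ], so [Y^-1] is bounded,
    and [D = Y - X] solves [D + sum_i B_i^* D C_i = O(delta)] with [C_i = Y^-1 A_i].  Since
    [sum_i B_i^* X B_i = X - Q <= r X] and similarly [sum_i C_i^* Y C_i <= r Y] with [r < 1],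
    the map [D |-> sum_i B_i^* D C_i] is a contraction for the norm
    [sup |u^* D v| / (u^* X u + v^* Y v)].  Hence [D = O(delta)], and the expansion gives
    [D = Lambda^-1 (dQ + sum_i (dA_i^* B_i + B_i^* dA_i)) + O(delta^2)].

    Lower bound.  Fix a direction [(dA, H)] with first-order response [Y], perturb [A] by
    [t dA], prescribe the solution [X + t Y], and let the equation define [dQ = t H + O(t^2)];
    no existence theorem for the perturbed equation is needed.

    It remains to identify the norm of the first-order response map, restricted to Hermitian
    [dQ], with the spectral norm.  [Lambda] commutes with the adjoint, hence a general [dQ]
    splits into its Hermitian and skew-Hermitian parts, whose responses are orthogonal; the
    latter becomes Hermitian after multiplication by [i]. *)

Set Implicit Arguments.
Unset Strict Implicit.
Unset Printing Implicit Defensive.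
Local Open Scope sesquilinear_scope.

(** * Frobenius norm *)

Section FrobeniusNorm.
Variable R : realType.
Local Notation frob := (@frobenius_norm R _ _).
Local Notation normc := (@Normc.normc R).

(** Lagrange's identity: the double sum of [(a i * b j - a j * b i) ^+ 2] is twice the gap between
    the two sides. *)
Lemma cauchy_schwarz_sum (I : finType) (a b : I -> R) :
  (\sum_i a i * b i) ^+ 2 <= (\sum_i a i ^+ 2) * (\sum_i b i ^+ 2).
Proof.
have : 0 <= \sum_i \sum_j (a i * b j - a j * b i) ^+ 2.
  by apply: sumr_ge0 => i _; apply: sumr_ge0 => j _; exact: sqr_ge0.
have -> : \sum_i \sum_j (a i * b j - a j * b i) ^+ 2 =
   ((\sum_i a i ^+ 2) * (\sum_i b i ^+ 2) - (\sum_i a i * b i) ^+ 2) *+ 2.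
  rewrite mulr2n [X in _ = X + _]/= {2}[(\sum_i a i ^+ 2) * _]mulrC.
  rewrite expr2 !big_distrlr /= -!sumrB -!big_split /=.
  apply: eq_bigr => i _; rewrite -!sumrB -!big_split /=.
  by apply: eq_bigr => j _; ring.
by rewrite pmulrn_lge0 // subr_ge0.
Qed.

Lemma minkowski_sum (I : finType) (a b : I -> R) :
  Num.sqrt (\sum_i (a i + b i) ^+ 2) <=
  Num.sqrt (\sum_i a i ^+ 2) + Num.sqrt (\sum_i b i ^+ 2).
Proof.
have sum_sqr_ge0 (c : I -> R) : 0 <= \sum_i c i ^+ 2.
  by apply: sumr_ge0 => i _; exact: sqr_ge0.
have ab_le : \sum_i a i * b i <=
    Num.sqrt (\sum_i a i ^+ 2) * Num.sqrt (\sum_i b i ^+ 2).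
  rewrite -sqrtrM //; apply: le_trans (ler_norm _) _.
  rewrite -sqrtr_sqr; apply: ler_wsqrtr; exact: cauchy_schwarz_sum.
rewrite -(@ler_pXn2r _ 2) ?nnegrE ?addr_ge0 ?sqrtr_ge0 //.
rewrite sqrrD !sqr_sqrtr //.
under eq_bigr do rewrite sqrrD.
rewrite big_split /= lerD2r big_split /= lerD2l sumrMnl.
by rewrite lerMn2r.
Qed.

Lemma normc_ge0 (z : R[i]) : 0 <= normc z.
Proof. by case: z => a b; exact: sqrtr_ge0. Qed.

Lemma normc_sqr (z : R[i]) : normc z ^+ 2 = complex.Re z ^+ 2 + complex.Im z ^+ 2.
Proof. by case: z => a b; rewrite sqr_sqrtr // addr_ge0 ?sqr_ge0. Qed.

Lemma normc_conj (z : R[i]) : normc z^* = normc z.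
Proof. by case: z => a b /=; rewrite sqrrN. Qed.

Lemma normc_real (a : R) : normc a%:C%C = `|a|.
Proof. by rewrite /= expr0n addr0 sqrtr_sqr. Qed.

Lemma normc_sum (I : finType) (F : I -> R[i]) :
  normc (\sum_i F i) <= \sum_i normc (F i).
Proof.
elim/big_rec2: _ => [|i y1 y2 _ IH]; first by rewrite Normc.normc0.
by apply: le_trans (le_normcD _ _) _; rewrite lerD2l.
Qed.

Lemma frob_ge0 p q (A : 'M[R[i]]_(p, q)) : 0 <= frob A.
Proof. exact: sqrtr_ge0. Qed.

Lemma frob_sqr p q (A : 'M[R[i]]_(p, q)) :
  frob A ^+ 2 = \sum_i \sum_j normc (A i j) ^+ 2.
Proof.
by rewrite sqr_sqrtr // sumr_ge0 // => i _; rewrite sumr_ge0 // => j _; exact: sqr_ge0.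
Qed.

Lemma frobE p q (A : 'M[R[i]]_(p, q)) :
  frob A = Num.sqrt (\sum_k normc (A k.1 k.2) ^+ 2).
Proof. by rewrite /frobenius_norm pair_big. Qed.

Lemma frob0 p q : frob (0 : 'M[R[i]]_(p, q)) = 0.
Proof.
rewrite frobE big1 ?sqrtr0 // => k _.
by rewrite mxE Normc.normc0 expr0n.
Qed.

Lemma frob_eq0 p q (A : 'M[R[i]]_(p, q)) : frob A = 0 -> A = 0.
Proof.
move=> /(congr1 (fun x => x ^+ 2)); rewrite frob_sqr expr0n /= => /eqP.
rewrite psumr_eq0 => [/allP A0|i _]; last by rewrite sumr_ge0 // => j _; exact: sqr_ge0.
apply/matrixP => i j; rewrite mxE.
have := A0 i; rewrite mem_index_enum => /(_ isT) /=.
rewrite psumr_eq0 => [/allP /(_ j)|k _]; last exact: sqr_ge0.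
by rewrite mem_index_enum sqrf_eq0 => /(_ isT) /eqP /Normc.eq0_normc.
Qed.

Lemma frobD p q (A B : 'M[R[i]]_(p, q)) : frob (A + B) <= frob A + frob B.
Proof.
rewrite !frobE; apply: le_trans (minkowski_sum _ _).
apply: ler_wsqrtr; apply: ler_sum => k _; rewrite mxE.
by rewrite ler_pXn2r ?nnegrE ?addr_ge0 ?normc_ge0 //; exact: le_normcD.
Qed.

Lemma frobN p q (A : 'M[R[i]]_(p, q)) : frob (- A) = frob A.
Proof.
by rewrite !frobE; congr Num.sqrt; apply: eq_bigr => k _; rewrite mxE normcN.
Qed.

Lemma frobZ p q (a : R[i]) (A : 'M[R[i]]_(p, q)) : frob (a *: A) = normc a * frob A.
Proof.
apply/eqP; rewrite -(@eqrXn2 _ 2) ?mulr_ge0 ?normc_ge0 ?frob_ge0 //.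
rewrite exprMn !frob_sqr mulr_sumr; apply/eqP; apply: eq_bigr => i _.
by rewrite mulr_sumr; apply: eq_bigr => j _; rewrite mxE Normc.normcM exprMn.
Qed.

Lemma frob_adj p q (A : 'M[R[i]]_(p, q)) : frob (A^t* ) = frob A.
Proof.
rewrite /frobenius_norm exchange_big /=; congr Num.sqrt.
by apply: eq_bigr => i _; apply: eq_bigr => j _; rewrite !mxE normc_conj.
Qed.

Lemma frob_sum p q (I : finType) (F : I -> 'M[R[i]]_(p, q)) :
  frob (\sum_i F i) <= \sum_i frob (F i).
Proof.
elim/big_rec2: _ => [|i y1 y2 _ IH]; first by rewrite frob0.
by apply: le_trans (frobD _ _) _; rewrite lerD2l.
Qed.

Lemma frobM p q r (A : 'M[R[i]]_(p, q)) (B : 'M[R[i]]_(q, r)) :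
  frob (A *m B) <= frob A * frob B.
Proof.
rewrite -(@ler_pXn2r _ 2) ?nnegrE ?mulr_ge0 ?frob_ge0 //.
rewrite exprMn !frob_sqr mulr_suml; apply: ler_sum => i _.
rewrite exchange_big mulr_sumr; apply: ler_sum => j _ /=.
rewrite mxE; apply: le_trans (cauchy_schwarz_sum _ _).
rewrite ler_pXn2r ?nnegrE ?normc_ge0 //; last first.
  by rewrite sumr_ge0 // => k _; rewrite mulr_ge0 ?normc_ge0.
by apply: le_trans (normc_sum _) _; under eq_bigr do rewrite Normc.normcM.
Qed.

Lemma normc_le_frob p q (A : 'M[R[i]]_(p, q)) i j : normc (A i j) <= frob A.
Proof.
rewrite -(@ler_pXn2r _ 2) ?nnegrE ?frob_ge0 ?normc_ge0 //.
rewrite frob_sqr (bigD1 i) // (bigD1 j) //= -addrA lerDl.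
by rewrite addr_ge0 ?sumr_ge0 // => k _; rewrite ?sumr_ge0 // => *; exact: sqr_ge0.
Qed.

Lemma frob_le_sum p q (A : 'M[R[i]]_(p, q)) : frob A <= \sum_i \sum_j normc (A i j).
Proof.
have S_ge0 : 0 <= \sum_k normc (A k.1 k.2) by rewrite sumr_ge0 // => *; exact: normc_ge0.
rewrite pair_big /= -(@ler_pXn2r _ 2) ?nnegrE ?frob_ge0 //.
rewrite frob_sqr pair_big expr2 mulr_suml; apply: ler_sum => k _ /=.
rewrite expr2 ler_wpM2l ?normc_ge0 // (bigD1 k) //= lerDl.
by rewrite sumr_ge0 // => *; exact: normc_ge0.
Qed.

End FrobeniusNorm.

(** * Hermitian forms *)

Section HermitianForms.
Variables (R : realType).
Local Notation C := R[i].
Local Notation frob := (@frobenius_norm R _ _).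
Local Notation normc := (@Normc.normc R).

Lemma adj_mulmx p q r (A : 'M[C]_(p, q)) (B : 'M[C]_(q, r)) :
  (A *m B)^t* = B^t* *m A^t*.
Proof. by rewrite trmx_mul map_mxM. Qed.

Lemma adjD p q (A B : 'M[C]_(p, q)) : (A + B)^t* = A^t* + B^t*.
Proof. by rewrite linearD map_mxD. Qed.

Lemma adjN p q (A : 'M[C]_(p, q)) : (- A)^t* = - A^t*.
Proof. by rewrite linearN map_mxN. Qed.

Lemma adjB p q (A B : 'M[C]_(p, q)) : (A - B)^t* = A^t* - B^t*.
Proof. by rewrite adjD adjN. Qed.

Lemma adjZ p q (a : C) (A : 'M[C]_(p, q)) : (a *: A)^t* = a^* *: A^t*.
Proof. by rewrite linearZ map_mxZ. Qed.

Lemma adj_sum p q (I : finType) (F : I -> 'M[C]_(p, q)) :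
  (\sum_i F i)^t* = \sum_i (F i)^t*.
Proof. by rewrite linear_sum raddf_sum. Qed.

Lemma adjK p q (A : 'M[C]_(p, q)) : A^t*^t* = A.
Proof. by apply/matrixP => i j; rewrite !mxE conjCK. Qed.

Lemma adj_invmx n (X : 'M[C]_n) : (invmx X)^t* = invmx (X^t* ).
Proof. by rewrite trmx_inv map_invmx. Qed.

Lemma hermsymmxP n (X : 'M[C]_n) : reflect (X^t* = X) (X \is hermsymmx).
Proof.
apply: (iffP (is_hermitianmxP _ _ _)); rewrite expr0 scale1r => h; first by rewrite -h.
by rewrite h.
Qed.

Lemma unitmx_ker0 (K : fieldType) n (A : 'M[K]_n) :
  (forall u : 'cV_n, A *m u = 0 -> u = 0) -> A \in unitmx.
Proof.
move=> ker0; rewrite -unitmx_tr unitmxE unitfE; apply/det0P => -[v v0 vA].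
move/eqP: v0; apply; apply: trmx_inj; rewrite trmx0; apply: ker0.
by apply: trmx_inj; rewrite trmx_mul trmxK vA trmx0.
Qed.

Definition hform p q (D : 'M[C]_(p, q)) (u : 'cV[C]_p) (v : 'cV[C]_q) : C :=
  (u^t* *m D *m v) 0 0.

(** The real part makes values comparable in [R] for every [X], Hermitian or not. *)
Definition qform n (X : 'M[C]_n) (u : 'cV[C]_n) : R := complex.Re (hform X u u).

Lemma hformD p q (D E : 'M[C]_(p, q)) u v : hform (D + E) u v = hform D u v + hform E u v.
Proof. by rewrite /hform mulmxDr mulmxDl mxE. Qed.

Lemma hformN p q (D : 'M[C]_(p, q)) u v : hform (- D) u v = - hform D u v.
Proof. by rewrite /hform mulmxN mulNmx mxE. Qed.

Lemma hformBl p q (D : 'M[C]_(p, q)) u v w : hform D (u - v) w = hform D u w - hform D v w.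
Proof. by rewrite /hform adjB !mulmxBl !mxE. Qed.

Lemma hformBr p q (D : 'M[C]_(p, q)) u v w : hform D u (v - w) = hform D u v - hform D u w.
Proof. by rewrite /hform mulmxBr !mxE. Qed.

Lemma hformZl p q (D : 'M[C]_(p, q)) a u v : hform D (a *: u) v = a^* * hform D u v.
Proof. by rewrite /hform adjZ -!scalemxAl mxE. Qed.

Lemma hformZr p q (D : 'M[C]_(p, q)) a u v : hform D u (a *: v) = a * hform D u v.
Proof. by rewrite /hform -scalemxAr mxE. Qed.

Lemma hform_sum p q (I : finType) (F : I -> 'M[C]_(p, q)) u v :
  hform (\sum_i F i) u v = \sum_i hform (F i) u v.
Proof. by rewrite /hform mulmx_sumr mulmx_suml summxE. Qed.

Lemma hform_congr p q k l (D : 'M[C]_(p, q)) (B : 'M[C]_(p, k)) (E : 'M[C]_(q, l)) u v :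
  hform (B^t* *m D *m E) u v = hform D (B *m u) (E *m v).
Proof. by rewrite /hform adj_mulmx !mulmxA. Qed.

Lemma hform_conj p q (D : 'M[C]_(p, q)) u v : (hform D u v)^* = hform (D^t* ) v u.
Proof.
rewrite /hform; have -> : v^t* *m D^t* *m u = (u^t* *m D *m v)^t*.
  by rewrite !adj_mulmx adjK mulmxA.
by rewrite [RHS]mxE [in RHS]mxE.
Qed.

Lemma ReD (x y : C) : complex.Re (x + y) = complex.Re x + complex.Re y.
Proof. by case: x; case: y. Qed.

Lemma ReN (x : C) : complex.Re (- x) = - complex.Re x.
Proof. by case: x. Qed.

Lemma Re_sum (I : finType) (F : I -> C) :
  complex.Re (\sum_i F i) = \sum_i complex.Re (F i).
Proof. by elim/big_rec2: _ => // i y1 y2 _ <-; exact: ReD. Qed.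

Lemma Re_le_normc (x : C) : complex.Re x <= normc x.
Proof.
apply: le_trans (ler_norm _) _; rewrite -(@ler_pXn2r _ 2) ?nnegrE ?normc_ge0 //.
by rewrite real_normK ?num_real // normc_sqr lerDl sqr_ge0.
Qed.

Lemma qformD n (X Y : 'M[C]_n) u : qform (X + Y) u = qform X u + qform Y u.
Proof. by rewrite /qform hformD ReD. Qed.

Lemma qformN n (X : 'M[C]_n) u : qform (- X) u = - qform X u.
Proof. by rewrite /qform hformN ReN. Qed.

Lemma qform_sum n (I : finType) (F : I -> 'M[C]_n) u :
  qform (\sum_i F i) u = \sum_i qform (F i) u.
Proof. by rewrite /qform hform_sum Re_sum. Qed.

Lemma qform_congr p q (X : 'M[C]_p) (B : 'M[C]_(p, q)) u :
  qform (B^t* *m X *m B) u = qform X (B *m u).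
Proof. by rewrite /qform hform_congr. Qed.

Lemma normc_hform_le p q (D : 'M[C]_(p, q)) u v :
  normc (hform D u v) <= frob D * (frob u * frob v).
Proof.
apply: le_trans (normc_le_frob _ _ _) _; apply: le_trans (frobM _ _) _.
rewrite mulrA; apply: ler_wpM2r; first exact: frob_ge0.
by apply: le_trans (frobM _ _) _; rewrite frob_adj mulrC.
Qed.

Lemma qform_abs_le n (X : 'M[C]_n) u : qform X u <= frob X * frob u ^+ 2.
Proof. by apply: le_trans (Re_le_normc _) _; rewrite expr2; exact: normc_hform_le. Qed.

Lemma qform_ge_opp n (X : 'M[C]_n) u : - (frob X * frob u ^+ 2) <= qform X u.
Proof. by rewrite lerNl -qformN -(frobN X); exact: qform_abs_le. Qed.

Lemma hform_delta p q (D : 'M[C]_(p, q)) i j :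
  hform D (delta_mx i 0) (delta_mx j 0) = D i j.
Proof.
rewrite /hform trmx_delta map_delta_mx -rowE -colE; first by rewrite !mxE.
Qed.

Lemma frob_sqr_col n (u : 'cV[C]_n) : frob u ^+ 2 = \sum_i normc (u i 0) ^+ 2.
Proof. by rewrite frob_sqr; apply: eq_bigr => i _; rewrite big_ord1. Qed.

Lemma frob_delta n (i : 'I_n) : frob (delta_mx i 0 : 'cV[C]_n) = 1.
Proof.
apply/eqP; rewrite -(@eqrXn2 _ 2) ?frob_ge0 // expr1n frob_sqr_col (bigD1 i) //=.
rewrite !mxE !eqxx Normc.normc1 expr1n big1 ?addr0 // => j /negPf ji.
by rewrite !mxE ji Normc.normc0 expr0n.
Qed.

Lemma coercive_unitmx n (X : 'M[C]_n) q : 0 < q ->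
  (forall u, q * frob u ^+ 2 <= qform X u) -> X \in unitmx.
Proof.
move=> q0 Xq; apply: unitmx_ker0 => u Xu0; apply: frob_eq0; apply/eqP.
rewrite -sqrf_eq0 eq_le sqr_ge0 andbT -(pmulr_rle0 _ q0).
by apply: le_trans (Xq u) _; rewrite /qform /hform -mulmxA Xu0 mulmx0 mxE.
Qed.

(** Coercivity at the column [W e_j] of [W = X^-1] gives [q |W e_j|^2 <= Re W_jj <= |W|]; summing
    over the [n] columns and cancelling one factor [|W|] gives the bound. *)
Lemma coercive_frob_invmx n (X : 'M[C]_n) q : 0 < q ->
  (forall u, q * frob u ^+ 2 <= qform X u) -> frob (invmx X) <= n%:R / q.
Proof.
move=> q0 Xq; set W := invmx X; have Xu := coercive_unitmx q0 Xq.
have : q * frob W ^+ 2 <= n%:R * frob W.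
  have -> : frob W ^+ 2 = \sum_(j < n) frob (W *m delta_mx j 0 : 'cV[C]_n) ^+ 2.
    rewrite frob_sqr exchange_big; apply: eq_bigr => j _.
    by rewrite frob_sqr_col -colE; apply: eq_bigr => i _; rewrite mxE.
  rewrite mulr_sumr -[n in n%:R]card_ord -sumr_const mulr_suml; apply: ler_sum => j _.
  apply: le_trans (Xq _) _; rewrite mul1r -qform_congr.
  rewrite -mulmxA mulmxV // mulmx1 -frob_adj /qform hform_delta.
  by apply: le_trans (Re_le_normc _) _; exact: normc_le_frob.
have [->|W0] := eqVneq (frob W) 0; first by rewrite divr_ge0 // ltW.
rewrite expr2 mulrA ler_pM2r ?lt_def ?W0 ?frob_ge0 //.
by rewrite ler_pdivlMr // mulrC.
Qed.

Lemma hermitian_posdef_qform n (X : 'M[C]_n) u :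
  hermitian_posdef X -> u != 0 -> 0 < qform X u.
Proof. by move=> [_ /(_ u) h] /h; rewrite /qform /hform ltcE => /andP []. Qed.

(** Coercivity without eigenvalues or compactness: [|u_i|^2 <= p_i u^* X u], where [p_i] is the i-th
    diagonal entry of [X^-1], and these bounds are summed. *)
Lemma hermitian_posdef_coercive n (X : 'M[C]_n) : hermitian_posdef X ->
  exists2 q, 0 < q & forall u, q * frob u ^+ 2 <= qform X u.
Proof.
move=> Xpd; have /hermsymmxP Xh := Xpd.1.
have Xu : X \in unitmx.
  apply: unitmx_ker0 => u Xu0; apply/eqP; apply/negPn/negP => /(hermitian_posdef_qform Xpd).
  by rewrite /qform /hform -mulmxA Xu0 mulmx0 mxE ltxx.
pose w i : 'cV[C]_n := invmx X *m delta_mx i 0.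
have w0 i : w i != 0.
  apply/eqP => /(congr1 (mulmx X)); rewrite mulKVmx // mulmx0 => /matrixP /(_ i 0) /eqP.
  by rewrite !mxE !eqxx oner_eq0.
pose p i := qform X (w i).
have p0 i : 0 < p i by exact: hermitian_posdef_qform.
(* Cauchy-Schwarz for the form X, applied to u and X^-1 e_i. *)
have coord (u : 'cV[C]_n) i : normc (u i 0) ^+ 2 <= p i * qform X u.
  (* [s *: w i] is the projection of [u] on [w i], orthogonal for the form of [X]. *)
  pose s : C := (p i)^-1%:C%C * u i 0.
  have hwu v : hform X (w i) v = v i 0.
    rewrite /hform -{1}Xh -adj_mulmx mulKVmx // trmx_delta map_delta_mx.
    by rewrite -rowE mxE.
  have hww : hform X (w i) (w i) = (p i)%:C%C.
    rewrite /p /qform; have : (hform X (w i) (w i))^* = hform X (w i) (w i).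
      by rewrite hform_conj Xh.
    case: (hform _ _ _) => a b [] /eqP; rewrite -subr_eq0 -opprD oppr_eq0 -mulr2n.
    by rewrite mulrn_eq0 /= => /eqP ->.
  have : 0 <= qform X (u - s *: w i).
    have [->|/(hermitian_posdef_qform Xpd)/ltW//] := eqVneq (u - s *: w i) 0.
    by rewrite /qform /hform mulmx0 mxE.
  have -> : qform X (u - s *: w i) = qform X u - normc (u i 0) ^+ 2 / p i.
    have huw : hform X u (w i) = (u i 0)^* by rewrite -hwu hform_conj Xh.
    rewrite /qform hformBl !hformBr !hformZl !hformZr hwu huw hww /s normc_sqr.
    have p_neq0 : p i != 0 by rewrite gt_eqF.
    by case: (u i 0) (hform X u u) => a b [x y] /=; field.
  by rewrite subr_ge0 ler_pdivrMr // mulrC.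
have P0 : 0 <= \sum_i p i by rewrite sumr_ge0 // => i _; exact: ltW.
(* The added 1 keeps the denominator positive when [n] is 0. *)
exists (1 + \sum_i p i)^-1; first by rewrite invr_gt0 ltr_pwDl.
move=> u; rewrite ler_pdivrMl ?ltr_pwDl // frob_sqr_col mulrDl mul1r.
apply: (@le_trans _ _ ((\sum_i p i) * qform X u)).
  by rewrite mulr_suml; apply: ler_sum => i _; exact: coord.
rewrite lerDr; have [->|/(hermitian_posdef_qform Xpd)/ltW//] := eqVneq u 0.
by rewrite /qform /hform mulmx0 mxE.
Qed.

(** A crude bound from [|u| |v| <= |u|^2 + |v|^2] and coercivity; it starts the iteration in
    [form_stability]. *)
Lemma normc_hform_le_qform n (X Y D : 'M[C]_n) q u v : 0 < q ->
  (forall u, q * frob u ^+ 2 <= qform X u) -> (forall u, q * frob u ^+ 2 <= qform Y u) ->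
  normc (hform D u v) <= frob D / q * (qform X u + qform Y v).
Proof.
move=> q0 Xq Yq.
apply: le_trans (normc_hform_le _ _ _) _; rewrite -mulrA ler_wpM2l ?frob_ge0 //.
rewrite ler_pdivlMl //; have := Xq u; have := Yq v.
have := sqr_ge0 (frob u - frob v); have := mulr_ge0 (ltW q0) (sqr_ge0 (frob u - frob v)).
have := mulr_ge0 (ltW q0) (mulr_ge0 (frob_ge0 u) (frob_ge0 v)).
nra.
Qed.

(* Weighting u by X and v by Y makes D |-> sum_i B_i^* D E_i an r-contraction, with neither
   square roots of X and Y nor the Cauchy-Schwarz inequality. *)
Lemma form_stability m n (X Y : 'M[C]_n) (B E : 'I_m -> 'M[C]_n) (D : 'M[C]_n) q r c :
  0 < q -> 0 <= r < 1 -> 0 <= c ->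
  (forall u, q * frob u ^+ 2 <= qform X u) -> (forall u, q * frob u ^+ 2 <= qform Y u) ->
  (forall u, \sum_i qform X (B i *m u) <= r * qform X u) ->
  (forall v, \sum_i qform Y (E i *m v) <= r * qform Y v) ->
  (forall u v, normc (hform (D + \sum_i (B i)^t* *m D *m E i) u v)
     <= c * (qform X u + qform Y v)) ->
  forall u v, normc (hform D u v) <= c / (1 - r) * (qform X u + qform Y v).
Proof.
move=> q0 /andP[r0 r1] c0 Xq Yq XB YE Dc.
have q2F (Z : 'M[C]_n) : (forall u, q * frob u ^+ 2 <= qform Z u) -> forall u, 0 <= qform Z u.
  by move=> Zq u; apply: le_trans (Zq u); rewrite mulr_ge0 ?sqr_ge0 // ltW.
have XY0 u v : 0 <= qform X u + qform Y v by rewrite addr_ge0 ?q2F.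
have base u v : normc (hform D u v) <= frob D / q * (qform X u + qform Y v).
  exact: normc_hform_le_qform.
have step k : (forall u v, normc (hform D u v) <= k * (qform X u + qform Y v)) -> 0 <= k ->
    forall u v, normc (hform D u v) <= (c + r * k) * (qform X u + qform Y v).
  move=> Dk k0 u v.
  have -> : hform D u v = hform (D + \sum_i (B i)^t* *m D *m E i) u v
      - \sum_i hform D (B i *m u) (E i *m v).
    by rewrite hformD hform_sum; under eq_bigr do rewrite hform_congr; rewrite addrK.
  apply: le_trans (le_normcD _ _) _; rewrite normcN mulrDl lerD //.
  apply: le_trans (normc_sum _) _.
  apply: (@le_trans _ _ (\sum_i k * (qform X (B i *m u) + qform Y (E i *m v)))).
    by apply: ler_sum => i _; exact: Dk.
  rewrite -mulr_sumr big_split /= [r * k]mulrC -mulrA ler_wpM2l // mulrDr.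
  by rewrite lerD.
(* The map [k |-> c + r * k], with fixed point [c / (1 - r)], is iterated from the crude constant;
   the excess decays like [r ^+ j] and vanishes in the limit. *)
have iter j u v : normc (hform D u v) <=
    (c / (1 - r) + r ^+ j * (frob D / q)) * (qform X u + qform Y v).
  elim: j u v => [|j IH] u v.
    apply: le_trans (base u v) _; rewrite expr0 mul1r ler_wpM2r // lerDr.
    by rewrite divr_ge0 // subr_ge0 ltW.
  apply: le_trans (step _ IH _ u v) _.
    rewrite addr_ge0 ?divr_ge0 ?subr_ge0 ?mulr_ge0 ?exprn_ge0 ?frob_ge0 ?invr_ge0 //; exact: ltW.
  suff -> : c + r * (c / (1 - r) + r ^+ j * (frob D / q)) =
      c / (1 - r) + r ^+ j.+1 * (frob D / q) by [].
  by rewrite exprS; field; rewrite subr_eq0 !gt_eqF.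
move=> u v.
have cv : (fun j => (c / (1 - r) + r ^+ j * (frob D / q)) * (qform X u + qform Y v)) @ \oo
    --> (c / (1 - r) + 0 * (frob D / q)) * (qform X u + qform Y v).
  apply: cvgMl; apply: cvgD; first exact: cvg_cst.
  by apply: cvgMl; apply: cvg_expr; rewrite ger0_norm.
rewrite -[c / _]addr0 -[X in c / _ + X](mul0r (frob D / q)).
rewrite -(cvg_lim _ cv) //; apply: limr_ge; first by apply/cvg_ex; eexists; exact: cv.
by near=> j; exact: iter.
Unshelve. all: by end_near.
Qed.

End HermitianForms.

(** * Order estimates *)

Section BigO.
Variables (R : realType) (T : Type) (P : T -> Prop) (d : T -> R).
Hypothesis d01 : forall t, P t -> 0 <= d t <= 1.
Local Notation C := R[i].
Local Notation frob := (@frobenius_norm R _ _).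

(** A uniform bound rather than a limit: one constant serves all [t] in [P], so [T] may index all
    perturbations at once, with [d t] their size. *)
Definition isO p q k (F : T -> 'M[C]_(p, q)) :=
  exists c : R, forall t, P t -> frob (F t) <= c * d t ^+ k.

Lemma isO_ge0 p q k (F : T -> 'M[C]_(p, q)) : isO k F ->
  exists2 c : R, 0 <= c & forall t, P t -> frob (F t) <= c * d t ^+ k.
Proof.
move=> [c Fc]; exists `|c| => // t Pt; apply: le_trans (Fc t Pt) _.
by have /andP[d0 _] := d01 Pt; rewrite ler_wpM2r ?exprn_ge0 // ler_norm.
Qed.

Lemma isO_cst p q (A : 'M[C]_(p, q)) : isO 0 (fun=> A).
Proof. by exists (frob A) => t _; rewrite expr0 mulr1. Qed.

Lemma isO_ext p q k (F G : T -> 'M[C]_(p, q)) :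
  (forall t, P t -> F t = G t) -> isO k F -> isO k G.
Proof. by move=> FG [c Fc]; exists c => t Pt; rewrite -FG //; exact: Fc. Qed.

Lemma isOD p q k (F G : T -> 'M[C]_(p, q)) :
  isO k F -> isO k G -> isO k (fun t => F t + G t).
Proof.
move=> [c Fc] [c' Gc]; exists (c + c') => t Pt; apply: le_trans (frobD _ _) _.
by rewrite mulrDl lerD ?Fc ?Gc.
Qed.

Lemma isON p q k (F : T -> 'M[C]_(p, q)) : isO k F -> isO k (fun t => - F t).
Proof. by move=> [c Fc]; exists c => t Pt; rewrite frobN; exact: Fc. Qed.

Lemma isOB p q k (F G : T -> 'M[C]_(p, q)) :
  isO k F -> isO k G -> isO k (fun t => F t - G t).
Proof. by move=> OF OG; apply: isOD OF (isON OG). Qed.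

Lemma isO_sum p q k (I : finType) (F : I -> T -> 'M[C]_(p, q)) :
  (forall i, isO k (F i)) -> isO k (fun t => \sum_i F i t).
Proof.
move=> /(_ _)/cid OF; exists (\sum_i projT1 (OF i)) => t Pt.
apply: le_trans (frob_sum _) _; rewrite mulr_suml; apply: ler_sum => i _.
by case: (OF i) => c /= /(_ t Pt).
Qed.

Lemma isOM p q r k l (F : T -> 'M[C]_(p, q)) (G : T -> 'M[C]_(q, r)) :
  isO k F -> isO l G -> isO (k + l) (fun t => F t *m G t).
Proof.
move=> [c Fc] [c' Gc]; exists (c * c') => t Pt; apply: le_trans (frobM _ _) _.
by rewrite exprD mulrACA ler_pM ?frob_ge0 ?Fc ?Gc.
Qed.

Lemma isO_adj p q k (F : T -> 'M[C]_(p, q)) : isO k F -> isO k (fun t => (F t)^t* ).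
Proof. by move=> [c Fc]; exists c => t Pt; rewrite frob_adj; exact: Fc. Qed.

Lemma isO_le p q k l (F : T -> 'M[C]_(p, q)) : (l <= k)%N -> isO k F -> isO l F.
Proof.
move=> lk /isO_ge0 [c c0 Fc]; exists c => t Pt; apply: le_trans (Fc t Pt) _.
by have /andP[d0 d1] := d01 Pt; rewrite ler_wpM2l // ler_wiXn2l.
Qed.

End BigO.

Lemma isO_sub (R : realType) (T : Type) (P P' : T -> Prop) (d : T -> R)
    p q k (F : T -> 'M[R[i]]_(p, q)) :
  (forall t, P' t -> P t) -> isO P d k F -> isO P' d k F.
Proof. by move=> P'P [c Fc]; exists c => t /P'P; exact: Fc. Qed.

(** Products and big sums become atoms; the remaining additive identity is checked entrywise by
    [ring]. *)
Ltac zmod_ring_mx :=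
  repeat match goal with
  | |- context [@mulmx ?S ?m ?n ?p ?A ?B] => move: (@mulmx S m n p A B) => ?
  | |- context [@bigop.body ?S ?I ?x ?r ?F] => move: (@bigop.body S I x r F) => ?
  end;
  let k := fresh in let l := fresh in apply/matrixP => k l; rewrite !mxE; ring.

(** The hypothesis is the resolvent identity for [V = X^-1] and [W = (X + D)^-1]; [a'] and [e']
    stand for adjoints. Each term of the last bracket has at least two small factors among [D],
    [W - V], [e], [e']. *)
Lemma congruence_expansion (K : comNzRingType) n (a e a' e' V W D : 'M[K]_n) :
  V *m D *m W = V - W ->
  (a' + e') *m W *m (a + e) - a' *m V *m a =
  (e' *m (V *m a) + (a' *m V) *m e) - (a' *m V) *m D *m (V *m a) -
  ((a' *m V) *m D *m (W - V) *m a - e' *m (W - V) *m a - a' *m (W - V) *m e - e' *m W *m e).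
Proof.
move=> VDW.
have -> : a' *m V *m D *m (W - V) *m a =
    a' *m (V *m D *m W) *m a - a' *m V *m D *m (V *m a).
  by rewrite mulmxBr mulmxBl !mulmxA.
rewrite VDW !(mulmxDl, mulmxDr, mulmxN, mulNmx) !mulmxA.
zmod_ring_mx.
Qed.

(** * Expansion of the residual *)

Section Expansion.
Variables (R : realType) (m n : nat).
Local Notation C := R[i].
Local Notation frob := (@frobenius_norm R _ _).
Implicit Types (A dA : 'I_m -> 'M[C]_n) (X D : 'M[C]_n).

Definition residual A X := X - \sum_i (A i)^t* *m invmx X *m A i.

(** The derivative of [residual A] at a Hermitian [X] in the direction [D]; its matrix on [vec D] is
    [Lmx A X]. *)
Definition lyapunov A X D := D + \sum_i (Bmx A X i)^t* *m D *m Bmx A X i.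

(** Minus the derivative of the residual in [A], so that it stands beside [dQ] in the linearized
    equation. *)
Definition first_order A X dA :=
  \sum_i ((dA i)^t* *m Bmx A X i + (Bmx A X i)^t* *m dA i).

Lemma lyapunovD A X D E : lyapunov A X (D + E) = lyapunov A X D + lyapunov A X E.
Proof.
rewrite /lyapunov addrACA -big_split; congr (_ + _).
by apply: eq_bigr => i _; rewrite mulmxDr mulmxDl.
Qed.

Lemma lyapunovZ A X a D : lyapunov A X (a *: D) = a *: lyapunov A X D.
Proof.
rewrite /lyapunov scalerDr scaler_sumr; congr (_ + _).
by apply: eq_bigr => i _; rewrite -scalemxAr -scalemxAl.
Qed.

Lemma lyapunovB A X D E : lyapunov A X (D - E) = lyapunov A X D - lyapunov A X E.
Proof. by rewrite lyapunovD -[in LHS]scaleN1r lyapunovZ scaleN1r. Qed.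

Lemma lyapunov_adj A X D : (lyapunov A X D)^t* = lyapunov A X (D^t* ).
Proof.
rewrite /lyapunov adjD adj_sum; congr (_ + _); apply: eq_bigr => i _.
by move: (Bmx _ _ _) => B; rewrite !adj_mulmx adjK mulmxA.
Qed.

Lemma first_order_adj A X dA : (first_order A X dA)^t* = first_order A X dA.
Proof.
rewrite /first_order adj_sum; apply: eq_bigr => i _.
by move: (Bmx _ _ _) => B; rewrite adjD !adj_mulmx !adjK addrC.
Qed.

Lemma first_order0 A X : first_order A X (fun=> 0) = 0.
Proof.
rewrite /first_order big1 // => i _.
by rewrite mulmx0 addr0 trmx0 map_mx0 mul0mx.
Qed.

Lemma first_orderZ A X (t : R) dA :
  first_order A X (fun i => t%:C%C *: dA i) = t%:C%C *: first_order A X dA.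
Proof.
rewrite /first_order scaler_sumr; apply: eq_bigr => i _.
rewrite adjZ scalerDr -scalemxAl -scalemxAr; congr (_ *: _ + _); exact: conjc_real.
Qed.

Lemma invmxB n' (X Y : 'M[C]_n') : X \in unitmx -> Y \in unitmx ->
  invmx Y - invmx X = - (invmx X *m (Y - X) *m invmx Y).
Proof.
move=> Xu Yu; rewrite mulmxBr mulmxBl mulVmx // mul1mx -mulmxA mulmxV //.
by rewrite mulmx1 opprB.
Qed.

Lemma adj_Bmx A X i : X^t* = X -> (Bmx A X i)^t* = (A i)^t* *m invmx X.
Proof. by move=> Xh; rewrite adj_mulmx adj_invmx Xh. Qed.

(** Each term has two small factors, among [dA i], its adjoint, [Xt - X] and the difference of the
    inverses. *)
Definition remainder A X dA Xt :=
  \sum_i ((Bmx A X i)^t* *m (Xt - X) *m (invmx Xt - invmx X) *m A i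
    - (dA i)^t* *m (invmx Xt - invmx X) *m A i
    - (A i)^t* *m (invmx Xt - invmx X) *m dA i
    - (dA i)^t* *m invmx Xt *m dA i).

Lemma residual_expansion A X dA Xt : X^t* = X -> X \in unitmx -> Xt \in unitmx ->
  residual (fun i => A i + dA i) Xt - residual A X =
  lyapunov A X (Xt - X) - first_order A X dA + remainder A X dA Xt.
Proof.
move=> Xh Xu Xtu; set D := Xt - X; set W := invmx Xt; set V := invmx X.
have VDW : V *m D *m W = V - W by rewrite -[LHS]opprK -invmxB // opprB.
have split_term i : (A i + dA i)^t* *m W *m (A i + dA i) - (A i)^t* *m V *m A i =
    ((dA i)^t* *m Bmx A X i + (Bmx A X i)^t* *m dA i) -
    (Bmx A X i)^t* *m D *m Bmx A X i -
    ((Bmx A X i)^t* *m D *m (W - V) *m A i - (dA i)^t* *m (W - V) *m A i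
      - (A i)^t* *m (W - V) *m dA i - (dA i)^t* *m W *m dA i).
  by rewrite adjD adj_Bmx //; exact: congruence_expansion.
have -> : residual (fun i => A i + dA i) Xt - residual A X =
    D - \sum_i ((A i + dA i)^t* *m W *m (A i + dA i) - (A i)^t* *m V *m A i).
  by rewrite /residual sumrB /D; zmod_ring_mx.
rewrite (eq_bigr _ (fun i _ => split_term i)) !sumrB /lyapunov /first_order /remainder -/V -/W -/D.
rewrite !sumrB; zmod_ring_mx.
Qed.

(** The difference of the inverses is [- X^-1 (Xt - X) Xt^-1], of first order once [Xt^-1] is
    bounded; every term then multiplies two first-order factors. *)
Lemma isO_remainder (T : Type) (P : T -> Prop) (d : T -> R) A X
    (dA : T -> 'I_m -> 'M[C]_n) (Xt : T -> 'M[C]_n) :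
  (forall t, P t -> 0 <= d t <= 1) ->
  X \in unitmx -> (forall t, P t -> Xt t \in unitmx) ->
  (forall i, isO P d 1 (fun t => dA t i)) -> isO P d 1 (fun t => Xt t - X) ->
  isO P d 0 (fun t => invmx (Xt t)) ->
  isO P d 2 (fun t => remainder A X (dA t) (Xt t)).
Proof.
move=> d01 Xu Xtu OdA OD OW.
have OdW : isO P d 1 (fun t => invmx (Xt t) - invmx X).
  apply: (@isO_ext _ _ _ _ _ _ _ (fun t => - (invmx X *m (Xt t - X) *m invmx (Xt t)))).
    by move=> t Pt; rewrite invmxB // Xtu.
  apply: isON; apply: (isOM (k := 1) (l := 0)) => //.
  by apply: (isOM (k := 0) (l := 1)) => //; exact: isO_cst.
apply: isO_sum => i; apply: isOB => //; last first.
  apply: (isOM (k := 1) (l := 1)) => //.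
  by apply: (isOM (k := 1) (l := 0)) => //; exact: isO_adj.
apply: isOB => //; last first.
  apply: (isOM (k := 1) (l := 1)) => //.
  by apply: (isOM (k := 0) (l := 1)) => //; exact: isO_cst.
apply: isOB.
  apply: (isOM (k := 2) (l := 0)); last exact: isO_cst.
  apply: (isOM (k := 1) (l := 1)) => //.
  by apply: (isOM (k := 0) (l := 1)) => //; exact: isO_cst.
apply: (isOM (k := 2) (l := 0)); last exact: isO_cst.
by apply: (isOM (k := 1) (l := 1)) => //; exact: isO_adj.
Qed.

End Expansion.

(** * Norm of the scaled perturbation *)

Section Scaled.
Variables (R : realType).
Local Notation C := R[i].
Local Notation frob := (@frobenius_norm R _ _).

Lemma frob_row_mx p q1 q2 (A : 'M[C]_(p, q1)) (B : 'M[C]_(p, q2)) :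
  frob (row_mx A B) ^+ 2 = frob A ^+ 2 + frob B ^+ 2.
Proof.
rewrite !frob_sqr -big_split; apply: eq_bigr => i _ /=.
by rewrite big_split_ord; congr (_ + _); apply: eq_bigr => j _; rewrite (row_mxEl, row_mxEr).
Qed.

Lemma frob_mxrow m p (q : 'I_m -> nat) (A : forall i, 'M[C]_(p, q i)) :
  frob (\mxrow_i A i) ^+ 2 = \sum_i frob (A i) ^+ 2.
Proof.
rewrite frob_sqr exchange_big /=.
under [RHS]eq_bigr do rewrite frob_sqr exchange_big.
rewrite [RHS]sig_big_dep /= [RHS](reindex _ tagnat.sig_bij_on) /=.
by apply: eq_bigr => j _; apply: eq_bigr => i _; rewrite !mxE.
Qed.

Lemma frob_scaled_perturbation m n (eta : 'I_m -> R) rho (dA : 'I_m -> 'M[C]_n) dQ :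
  (forall i, 0 < eta i) -> 0 < rho ->
  frob (scaled_perturbation eta rho dA dQ) ^+ 2 =
  \sum_i (frob (dA i) / eta i) ^+ 2 + (frob dQ / rho) ^+ 2.
Proof.
move=> eta0 rho0; rewrite frob_row_mx frob_mxrow frobZ normc_real.
rewrite gtr0_norm ?invr_gt0 // [rho^-1 * _]mulrC; congr (_ + _).
by apply: eq_bigr => i _; rewrite frobZ normc_real gtr0_norm ?invr_gt0 // mulrC.
Qed.

Lemma frob_dA_le m n (eta : 'I_m -> R) rho (dA : 'I_m -> 'M[C]_n) dQ i :
  (forall i, 0 < eta i) -> 0 < rho ->
  frob (dA i) <= eta i * frob (scaled_perturbation eta rho dA dQ).
Proof.
move=> eta0 rho0; rewrite -ler_pdivrMl // mulrC.
rewrite -(@ler_pXn2r _ 2) ?nnegrE ?divr_ge0 ?frob_ge0 ?(ltW (eta0 i)) //.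
rewrite frob_scaled_perturbation // (bigD1 i) //= -addrA lerDl.
by rewrite addr_ge0 ?sqr_ge0 // sumr_ge0 // => j _; exact: sqr_ge0.
Qed.

Lemma frob_dQ_le m n (eta : 'I_m -> R) rho (dA : 'I_m -> 'M[C]_n) dQ :
  (forall i, 0 < eta i) -> 0 < rho ->
  frob dQ <= rho * frob (scaled_perturbation eta rho dA dQ).
Proof.
move=> eta0 rho0; rewrite -ler_pdivrMl // mulrC.
rewrite -(@ler_pXn2r _ 2) ?nnegrE ?divr_ge0 ?frob_ge0 ?(ltW rho0) //.
by rewrite frob_scaled_perturbation // lerDr sumr_ge0 // => j _; exact: sqr_ge0.
Qed.

(** Separates a scaled direction from a correction of [dQ] alone, such as the second-order part in
    [lower_bound]. *)
Lemma scaled_perturbationZD m n (eta : 'I_m -> R) rho (dA : 'I_m -> 'M[C]_n) dQ dQ' a :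
  scaled_perturbation eta rho (fun i => a *: dA i) (a *: dQ + dQ') =
  a *: scaled_perturbation eta rho dA dQ + scaled_perturbation eta rho (fun=> 0) dQ'.
Proof.
rewrite /scaled_perturbation scale_row_mx add_row_mx; congr row_mx.
  by apply/matrixP => k l; rewrite !mxE mulr0 addr0 mulrCA.
by rewrite scalerDr !scalerA mulrC.
Qed.

End Scaled.

(** * Stability of the linearized equation *)

Section Lyapunov.
Variables (R : realType) (m n : nat).
Local Notation C := R[i].
Local Notation frob := (@frobenius_norm R _ _).
Local Notation normc := (@Normc.normc R).
Implicit Types (A dA : 'I_m -> 'M[C]_n) (X D Q : 'M[C]_n).

(** Since [qform Z u <= K * frob u ^+ 2] for [Z] equal to [X] or [Y], a loss of [q * frob u ^+ 2] is
    a contraction by [r = 1 - q / K], and [form_stability] applies. Basis vectors then bound each of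
    the [n ^ 2] entries by [2 * K ^+ 2 / q ^+ 2] times the norm of the right-hand side. *)
Lemma frob_stability X Y (B E : 'I_m -> 'M[C]_n) D q K :
  0 < q -> q <= K -> frob X <= K -> frob Y <= K ->
  (forall u, q * frob u ^+ 2 <= qform X u) -> (forall u, q * frob u ^+ 2 <= qform Y u) ->
  (forall u, \sum_i qform X (B i *m u) <= qform X u - q * frob u ^+ 2) ->
  (forall v, \sum_i qform Y (E i *m v) <= qform Y v - q * frob v ^+ 2) ->
  frob D <= n%:R ^+ 2 * (2 * K ^+ 2 / q ^+ 2) *
    frob (D + \sum_i (B i)^t* *m D *m E i).
Proof.
move=> q0 qK XK YK Xq Yq XB YE; set F := D + _.
have K0 : 0 < K by exact: lt_le_trans qK.
have contr (Z : 'M[C]_n) (G : 'I_m -> 'M[C]_n) : frob Z <= K ->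
    (forall u, \sum_i qform Z (G i *m u) <= qform Z u - q * frob u ^+ 2) ->
    forall u, \sum_i qform Z (G i *m u) <= (1 - q / K) * qform Z u.
  move=> ZK ZG u; apply: le_trans (ZG u) _; rewrite mulrBl mul1r lerD2l lerN2.
  rewrite -mulrA ler_pM2l // mulrC ler_pdivrMr // mulrC.
  by apply: le_trans (qform_abs_le _ _) _; rewrite ler_wpM2r ?sqr_ge0.
have F_le u v : normc (hform F u v) <= frob F / q * (qform X u + qform Y v).
  exact: normc_hform_le_qform.
have qK1 : q / K <= 1 by rewrite ler_pdivrMr // mul1r.
have := @form_stability _ m n X Y B E D q (1 - q / K) (frob F / q) q0.
have -> : 0 <= 1 - q / K < 1 by rewrite subr_ge0 qK1 gtrBl divr_gt0.
rewrite divr_ge0 ?frob_ge0 ?(ltW q0) // => /(_ isT isT Xq Yq (contr _ _ XK XB)).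
move=> /(_ (contr _ _ YK YE) F_le) D_le.
apply: le_trans (frob_le_sum D) _.
apply: (@le_trans _ _ (\sum_(i < n) \sum_(j < n) (2 * K ^+ 2 / q ^+ 2 * frob F))).
  apply: ler_sum => i _; apply: ler_sum => j _; rewrite -(hform_delta D i j).
  apply: le_trans (D_le _ _) _.
  have -> : 2 * K ^+ 2 / q ^+ 2 * frob F = frob F / q / (1 - (1 - q / K)) * (K + K).
    have -> : 1 - (1 - q / K) = q / K by rewrite opprB addrC subrK.
    by field; rewrite !gt_eqF.
  rewrite ler_wpM2l ?lerD //.
  - by rewrite divr_ge0 ?divr_ge0 ?frob_ge0 ?(ltW q0) // opprB addrC subrK divr_ge0 ?ltW.
  - by apply: le_trans (qform_abs_le _ _) _; rewrite frob_delta expr1n mulr1.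
  - by apply: le_trans (qform_abs_le _ _) _; rewrite frob_delta expr1n mulr1.
by rewrite !sumr_const card_ord -[leLHS]mulr_natl -[X in _ * X <= _]mulr_natl expr2 !mulrA.
Qed.

Lemma qform_invmx X v : X^t* = X -> X \in unitmx -> qform (invmx X) v = qform X (invmx X *m v).
Proof. by move=> Xh Xu; rewrite -qform_congr adj_invmx Xh mulVmx // mul1mx. Qed.

Lemma congr_Bmx A X i : X^t* = X -> X \in unitmx ->
  (Bmx A X i)^t* *m X *m Bmx A X i = (A i)^t* *m invmx X *m A i.
Proof.
by move=> Xh Xu; rewrite adj_Bmx // /Bmx mulmxKV // mulmxA.
Qed.

(** [X - Q] is the sum of the [A_i^* X^-1 A_i], whose forms are nonnegative. *)
Lemma solution_ge A Q X u : is_hpd_solution A Q X -> qform Q u <= qform X u.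
Proof.
move=> [Xpd eqX]; have [q q0 Xq] := hermitian_posdef_coercive Xpd.
have Xh := hermsymmxP _ Xpd.1.
rewrite -eqX qformD qformN gerDl oppr_le0 qform_sum sumr_ge0 // => i _.
rewrite qform_congr qform_invmx ?(coercive_unitmx q0) //; apply: le_trans (Xq _).
by rewrite mulr_ge0 ?sqr_ge0 ?(ltW q0).
Qed.

(** By the equation, because [B_i^* X B_i = A_i^* X^-1 A_i]. With [Q] coercive, the [B_i] jointly
    contract the form of [X]. *)
Lemma solution_Bmx A Q X u : is_hpd_solution A Q X ->
  \sum_i qform X (Bmx A X i *m u) = qform X u - qform Q u.
Proof.
move=> [Xpd eqX]; have [q q0 Xq] := hermitian_posdef_coercive Xpd.
have Xh := hermsymmxP _ Xpd.1; have Xu := coercive_unitmx q0 Xq.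
rewrite -eqX qformD qformN opprD opprK addNKr qform_sum.
by apply: eq_bigr => i _; rewrite -qform_congr congr_Bmx.
Qed.

(** The unperturbed case of [frob_stability]. It yields the invertibility of [Lmx] and controls the
    response to the remainder. *)
Lemma lyapunov_bounded_below A Q X : hermitian_posdef Q -> is_hpd_solution A Q X ->
  exists2 k, 0 <= k & forall D,
    frob D <= k * frob (lyapunov A X D).
Proof.
move=> Qpd solX; have [q q0 Qq] := hermitian_posdef_coercive Qpd.
have Xq u : q * frob u ^+ 2 <= qform X u by apply: le_trans (solution_ge u solX).
pose K := frob X + q; have qK : q <= K by rewrite lerDr frob_ge0.
have XK : frob X <= K by rewrite lerDl ltW.
exists (n%:R ^+ 2 * (2 * K ^+ 2 / q ^+ 2)).
  by rewrite mulr_ge0 ?sqr_ge0 // divr_ge0 ?sqr_ge0 // mulr_ge0 ?sqr_ge0.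
have XB u : \sum_i qform X (Bmx A X i *m u) <= qform X u - q * frob u ^+ 2.
  by rewrite (solution_Bmx u solX) lerD2l lerN2.
by move=> D; apply: (@frob_stability X X (Bmx A X) (Bmx A X) D q K).
Qed.

End Lyapunov.

(** * Perturbed solutions *)

(** Arithmetic for the perturbed contraction: [f] is [frob v ^+ 2], and [qE], [qX], [qQ], [qd] are
    the forms of [E], [Xt], [Q], [dQ] at [v]. *)
Lemma shifted_form_arith (F : realFieldType) (qE qX qQ qd e g f q : F) :
  qE <= e * f -> - (g * f) <= qd -> q * f <= qQ -> (e + g) * f <= q / 2 * f ->
  qE + qX - qQ - qd <= qX - q / 2 * f.
Proof. lra. Qed.

Section Bounds.
Variables (R : realType) (m n : nat).
Local Notation C := R[i].
Local Notation M := 'M[C]_n.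
Local Notation frob := (@frobenius_norm R _ _).
Variables (A : 'I_m -> M) (Q X : M) (rho : R) (eta : 'I_m -> R).
Hypothesis Q_hpd : hermitian_posdef Q.
Hypothesis X_sol : is_hpd_solution A Q X.
Hypothesis rho_gt0 : 0 < rho.
Hypothesis eta_gt0 : forall i, 0 < eta i.

Let X_herm : X^t* = X := hermsymmxP _ X_sol.1.1.

Let X_unit : X \in unitmx.
Proof. by have [q q0 Xq] := hermitian_posdef_coercive X_sol.1; exact: coercive_unitmx Xq. Qed.

Section PerturbedFamily.
Variables (T : Type) (P : T -> Prop) (del : T -> R).
Variables (dA : T -> 'I_m -> M) (dQ Xt : T -> M).
Hypothesis del_ge0 : forall t, P t -> 0 <= del t.
Hypothesis dA_le : forall t i, P t -> frob (dA t i) <= eta i * del t.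
Hypothesis dQ_le : forall t, P t -> frob (dQ t) <= rho * del t.
Hypothesis Xt_sol : forall t, P t -> is_hpd_solution (fun i => A i + dA t i) (Q + dQ t) (Xt t).

(** First [Xt >= Q + dQ] bounds [Xt^-1], and the equation bounds [Xt]. Then [frob_stability], with
    left factors [X^-1 A_i] and right factors [Xt^-1 A_i], turns first-order data into a first-order
    bound on [Xt - X]. *)
Lemma perturbed_solution_bounds : exists2 d0, 0 < d0 <= 1 &
  let P0 := fun t => P t /\ del t <= d0 in
  [/\ isO P0 del 1 (fun t => Xt t - X), isO P0 del 0 (fun t => invmx (Xt t)) &
      forall t, P0 t -> Xt t \in unitmx].
Proof.
have [q q0 Qq] := hermitian_posdef_coercive Q_hpd.
(* Half of the coercivity of [Q] is kept; [rho * d1 <= h] lets [dQ] use up at most the other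
   half. *)
pose h := q / 2; have h0 : 0 < h by rewrite divr_gt0.
pose d1 := Num.min 1 (h / rho).
have d1_gt0 : 0 < d1 by rewrite lt_min ltr01 divr_gt0.
pose P1 t := P t /\ del t <= d1.
have P1_01 t : P1 t -> 0 <= del t <= 1.
  by move=> [Pt]; rewrite le_min => /andP[-> _]; rewrite del_ge0.
have Xt_herm t : P1 t -> (Xt t)^t* = Xt t.
  by move=> [Pt _]; exact: (hermsymmxP _ (Xt_sol Pt).1.1).
have Xt_ge t u : P1 t -> h * frob u ^+ 2 <= qform (Xt t) u.
  move=> [Pt]; rewrite le_min => /andP[_ dh].
  apply: le_trans (solution_ge u (Xt_sol Pt)); rewrite qformD.
  have := qform_ge_opp (dQ t) u; have := Qq u; have := dQ_le Pt.
  rewrite ler_pdivlMr // in dh; rewrite /h in dh *.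
  have := sqr_ge0 (frob u); move: (frob u ^+ 2) => f f0 h1 h2 h3.
  have : frob (dQ t) * f <= q / 2 * f.
    by rewrite ler_wpM2r // (le_trans h1) // mulrC.
  nra.
have Xt_unit t : P1 t -> Xt t \in unitmx.
  by move=> P1t; apply: (coercive_unitmx h0) => u; exact: Xt_ge.
have OW : isO P1 del 0 (fun t => invmx (Xt t)).
  exists (n%:R / h) => t P1t; rewrite expr0 mulr1.
  by apply: coercive_frob_invmx => // u; exact: Xt_ge.
have OdA i : isO P1 del 1 (fun t => dA t i).
  by exists (eta i) => t [Pt _]; rewrite expr1 dA_le.
have OdQ : isO P1 del 1 dQ by exists rho => t [Pt _]; rewrite expr1 dQ_le.
have OAt i : isO P1 del 0 (fun t => A i + dA t i).
  by apply: isOD; [exact: isO_cst | exact: isO_le (OdA i)].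
pose F t := \sum_i (A i + dA t i)^t* *m invmx (Xt t) *m (A i + dA t i).
have XtE t : P1 t -> Xt t = Q + dQ t + F t.
  by move=> [Pt _]; rewrite -(Xt_sol Pt).2 subrK.
have OF : isO P1 del 0 F.
  apply: isO_sum => i; apply: (isOM (k := 0) (l := 0)) => //.
  by apply: (isOM (k := 0) (l := 0)) => //; exact: isO_adj.
have OXt : isO P1 del 0 Xt.
  apply: (@isO_ext _ _ _ _ _ _ _ (fun t => Q + dQ t + F t)) => [t /XtE //|].
  apply: isOD => //; apply: isOD; first exact: isO_cst.
  exact: isO_le OdQ.
(* The effect of putting [A] back for the perturbed coefficients while keeping [Xt^-1]; it is of
   first order in [dA]. *)
pose E t := \sum_i ((A i)^t* *m invmx (Xt t) *m A i) - F t.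
have OE : isO P1 del 1 E.
  apply: (@isO_ext _ _ _ _ _ _ _ (fun t => \sum_i - ((A i)^t* *m invmx (Xt t) *m dA t i +
      (dA t i)^t* *m invmx (Xt t) *m (A i + dA t i)))).
    move=> t _; rewrite /E /F -sumrB; apply: eq_bigr => i _.
    rewrite adjD !(mulmxDl, mulmxDr).
    zmod_ring_mx.
  apply: isO_sum => i; apply: isON; apply: isOD.
    apply: (isOM (k := 0) (l := 1)) => //.
    by apply: (isOM (k := 0) (l := 0)) => //; exact: isO_cst.
  apply: (isOM (k := 1) (l := 0)) => //.
  by apply: (isOM (k := 1) (l := 0)) => //; exact: isO_adj.
have [cE cE0 E_le] := isO_ge0 P1_01 OE.
have [cX cX0 Xt_le] := isO_ge0 P1_01 OXt.
(* Ensures [frob (E t) + frob (dQ t) <= h], so that the right factors still contract the form of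
   [Xt t]. *)
pose d0 := Num.min d1 (h / (cE + rho)).
have cEr : 0 < cE + rho by rewrite ltr_wpDl.
have P0P1 t : P t /\ del t <= d0 -> P1 t.
  by move=> [Pt]; rewrite le_min => /andP[]; split.
exists d0.
  by rewrite lt_min d1_gt0 divr_gt0 //= !ge_min lexx.
split => //; last 2 first.
- exact: isO_sub OW.
- by move=> t /P0P1; exact: Xt_unit.
(* A common upper bound for [h] and the norms of [X] and [Xt t]. *)
pose K := frob X + cX + h.
have [hK XK cXK] : [/\ h <= K, frob X <= K & cX <= K].
  by rewrite /K; have := frob_ge0 X; split; lra.
have OR : isO (fun t => P t /\ del t <= d0) del 1 (fun t => dQ t - E t).
  by apply: (isO_sub P0P1); exact: isOB.
have [c c0 R_le] := isO_ge0 (fun t Pt => P1_01 t (P0P1 t Pt)) OR.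
exists (n%:R ^+ 2 * (2 * K ^+ 2 / h ^+ 2) * c) => t P0t.
have P1t := P0P1 _ P0t; have Pt := P1t.1.
(* Exact rather than approximate, because [X^-1 (Xt - X) Xt^-1 = X^-1 - Xt^-1] mixes the two
   inverses. *)
have stab : (Xt t - X) + \sum_i (Bmx A X i)^t* *m (Xt t - X) *m Bmx A (Xt t) i = dQ t - E t.
  have -> : \sum_i (Bmx A X i)^t* *m (Xt t - X) *m Bmx A (Xt t) i =
      \sum_i (A i)^t* *m invmx X *m A i - \sum_i (A i)^t* *m invmx (Xt t) *m A i.
    rewrite -sumrB; apply: eq_bigr => i _; rewrite adj_Bmx // /Bmx.
    have := invmxB X_unit (Xt_unit _ P1t) => /(congr1 -%R); rewrite opprK opprB => VW.
    by rewrite -mulmxBl -mulmxBr VW !mulmxA.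
  have -> : \sum_i (A i)^t* *m invmx X *m A i = X - Q.
    by rewrite -X_sol.2 opprB addrC subrK.
  rewrite {1}(XtE _ P1t) /E; move: (F t) (\sum_i _) => S S'; zmod_ring_mx.
rewrite -mulrA; apply: le_trans (_ : _ <= n%:R ^+ 2 * (2 * K ^+ 2 / h ^+ 2) * frob (dQ t - E t)) _.
  rewrite -stab; apply: (@frob_stability _ m n X (Xt t) (Bmx A X) (Bmx A (Xt t))) => //.
  - by apply: le_trans (Xt_le _ P1t) _; rewrite expr0 mulr1.
  - move=> u; apply: le_trans (solution_ge u X_sol); apply: le_trans (Qq u).
    by rewrite ler_wpM2r ?sqr_ge0 // /h; lra.
  - by move=> u; exact: Xt_ge.
  - move=> u; rewrite (solution_Bmx u X_sol) lerD2l lerN2; apply: le_trans (Qq u).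
    by rewrite ler_wpM2r ?sqr_ge0 // /h; lra.
  move=> v.
  have -> : \sum_i qform (Xt t) (Bmx A (Xt t) i *m v) =
      qform (E t) v + qform (Xt t) v - qform Q v - qform (dQ t) v.
    rewrite -!qformN -!qformD.
    have -> : E t + Xt t - Q - dQ t = \sum_i (A i)^t* *m invmx (Xt t) *m A i.
      rewrite {1}(XtE _ P1t) /E; move: (F t) (\sum_i _) => S S'; zmod_ring_mx.
    rewrite qform_sum; apply: eq_bigr => i _.
    by rewrite -qform_congr congr_Bmx ?Xt_herm ?Xt_unit.
  have := Qq v; have := qform_ge_opp (dQ t) v; have := qform_abs_le (E t) v.
  have : (cE + rho) * del t <= h.
    by case: P0t => _; rewrite le_min => /andP[_]; rewrite ler_pdivlMr // mulrC.
  have := E_le _ P1t; have := dQ_le Pt; rewrite expr1 => h1 h2 h3.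
  have : (frob (E t) + frob (dQ t)) * frob v ^+ 2 <= h * frob v ^+ 2.
    by rewrite ler_wpM2r ?sqr_ge0 //; lra.
  by move=> h4 h5 h6 h7; exact: shifted_form_arith h5 h6 h7 h4.
by rewrite ler_wpM2l ?R_le // mulr_ge0 ?sqr_ge0 // divr_ge0 ?sqr_ge0 // mulr_ge0 ?sqr_ge0.
Qed.

End PerturbedFamily.

(** [s] is any bound for the first-order response to Hermitian [dQ]; the true change differs from
    that response by a quadratic term, uniformly in the perturbation. *)
Lemma upper_bound (s : R) : 0 <= s ->
  (forall F : M, exists Z, lyapunov A X Z = F) ->
  (forall dA dQ Y, dQ \is hermsymmx -> lyapunov A X Y = dQ + first_order A X dA ->
    frob Y <= s * frob (scaled_perturbation eta rho dA dQ)) ->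
  exists d0 k : R, [/\ 0 < d0, 0 <= k & forall delta dA dQ Xt, 0 <= delta <= d0 ->
    dQ \is hermsymmx -> frob (scaled_perturbation eta rho dA dQ) <= delta ->
    is_hpd_solution (fun i => A i + dA i) (Q + dQ) Xt ->
    frob (Xt - X) <= s * delta + k * delta ^+ 2].
Proof.
move=> s0 solvable lin_le.
(* An index is a size bound with a perturbation and its solution, so the constants are uniform over
   all of them. *)
pose T := (R * ('I_m -> M) * M * M)%type.
pose del (t : T) := t.1.1.1; pose dA (t : T) := t.1.1.2.
pose dQ (t : T) := t.1.2; pose Xt (t : T) := t.2.
pose P (t : T) := [/\ 0 <= del t, dQ t \is hermsymmx,
  frob (scaled_perturbation eta rho (dA t) (dQ t)) <= del t &
  is_hpd_solution (fun i => A i + dA t i) (Q + dQ t) (Xt t)].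
have dA_le t i : P t -> frob (dA t i) <= eta i * del t.
  move=> [_ _ le _]; apply: le_trans (frob_dA_le _ (dQ t) i eta_gt0 rho_gt0) _.
  by rewrite ler_pM2l.
have dQ_le t : P t -> frob (dQ t) <= rho * del t.
  move=> [_ _ le _]; apply: le_trans (frob_dQ_le (dA t) _ eta_gt0 rho_gt0) _.
  by rewrite ler_pM2l.
have [||d0 /andP[d0_gt0 d0_le1] [OD OW Xtu]] :=
  perturbed_solution_bounds _ dA_le dQ_le (Xt := Xt).
- by move=> t [].
- by move=> t [].
pose P0 t := P t /\ del t <= d0.
have P0_01 t : P0 t -> 0 <= del t <= 1.
  by move=> [[-> _ _ _] /le_trans]; apply.
have OdA i : isO P0 del 1 (fun t => dA t i).
  by exists (eta i) => t [Pt _]; rewrite expr1 dA_le.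
have [c c0 Rem_le] := isO_ge0 P0_01 (isO_remainder A P0_01 X_unit Xtu OdA OD OW).
have [k k0 lyap] := lyapunov_bounded_below Q_hpd X_sol.
exists d0, (k * c); split; [by [] | exact: mulr_ge0 |].
move=> delta dA' dQ' Xt' /andP[delta0 delta_le] dQ'h le_delta sol'.
pose t : T := (delta, dA', dQ', Xt').
have P0t : P0 t by split.
have := residual_expansion A dA' X_herm X_unit (Xtu t P0t).
rewrite {1}/residual [\sum_i _]/= -[X in X = _]/(_ - residual A X).
have -> : Xt' - \sum_i (A i + dA' i)^t* *m invmx Xt' *m (A i + dA' i) = Q + dQ'.
  exact: sol'.2.
have -> : residual A X = Q by exact: X_sol.2.
rewrite addrC addrA addNr add0r => dQ_eq.
(* [Z] absorbs the remainder: [Xt' - X - Z] solves the linearized equation exactly, and [Z] is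
   quadratic in [delta]. *)
have [Z Z_eq] := solvable (- remainder A X dA' Xt').
have lin_eq : lyapunov A X (Xt' - X - Z) = dQ' + first_order A X dA'.
  by rewrite lyapunovB Z_eq opprK dQ_eq [RHS]addrAC subrK.
have -> : Xt' - X = (Xt' - X - Z) + Z by rewrite subrK.
apply: le_trans (frobD _ _) _; apply: lerD.
  by apply: le_trans (lin_le _ _ _ dQ'h lin_eq) _; rewrite ler_wpM2l.
apply: le_trans (lyap _) _; rewrite Z_eq frobN -mulrA ler_wpM2l //.
exact: (Rem_le t).
Qed.

Lemma coercive_hermitian_posdef (Y : M) q : Y^t* = Y -> 0 < q ->
  (forall u, q * frob u ^+ 2 <= qform Y u) -> hermitian_posdef Y.
Proof.
move=> Yh q0 Yq; split; first exact/hermsymmxP.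
move=> u u0; rewrite -[X in 0 < X]/(hform Y u u) ltcE /=; apply/andP; split.
  have : (hform Y u u)^* = hform Y u u by rewrite hform_conj Yh.
  case: (hform Y u u) => a b [] /eqP; rewrite -subr_eq0 -opprD oppr_eq0 -mulr2n.
  by rewrite mulrn_eq0.
apply: lt_le_trans (Yq u); rewrite mulr_gt0 // exprn_gt0 // lt_def frob_ge0 andbT.
by apply: contra_neq u0 => /frob_eq0.
Qed.

Lemma residual_adj (B : 'I_m -> M) Y : Y^t* = Y -> (residual B Y)^t* = residual B Y.
Proof.
move=> Yh; rewrite /residual adjB adj_sum Yh; congr (_ - _); apply: eq_bigr => i _.
by rewrite !adj_mulmx adj_invmx Yh adjK mulmxA.
Qed.

(** [dQ] is read off as the residual at [X + t Y] minus [Q]; the excess [c * t ^+ 2] bounds the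
    remainder divided by [rho]. *)
Lemma lower_bound dA H Y : H \is hermsymmx -> lyapunov A X Y = H + first_order A X dA ->
  frob (scaled_perturbation eta rho dA H) <= 1 ->
  exists t0 c : R, [/\ 0 < t0, 0 <= c & forall t, 0 <= t <= t0 ->
    exists dQ, [/\ dQ \is hermsymmx,
      frob (scaled_perturbation eta rho (fun i => t%:C%C *: dA i) dQ) <= t + c * t ^+ 2 &
      is_hpd_solution (fun i => A i + t%:C%C *: dA i) (Q + dQ) (X + t%:C%C *: Y)]].
Proof.
move=> /hermsymmxP Hh linY le1.
have [k k0 lyap] := lyapunov_bounded_below Q_hpd X_sol.
(* [Y] minus its adjoint is in the kernel of the Lyapunov operator, which is bounded below. *)
have Yh : Y^t* = Y.
  apply/eqP; rewrite -subr_eq0; apply/eqP; apply: frob_eq0; apply/eqP.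
  rewrite eq_le frob_ge0 andbT; apply: le_trans (lyap _) _.
  by rewrite lyapunovB -lyapunov_adj linY adjD first_order_adj Hh subrr frob0 mulr0.
have [q q0 Xq] := hermitian_posdef_coercive X_sol.1.
pose h := q / 2; have h0 : 0 < h by rewrite divr_gt0.
(* For [t <= t0] the term [t Y] costs at most half of the coercivity of [X]; the added 1 avoids a
   zero denominator. *)
pose t0 := Num.min 1 (h / (frob Y + 1)).
have t0_gt0 : 0 < t0 by rewrite lt_min ltr01 divr_gt0 // ltr_wpDl ?frob_ge0.
pose P (t : R) := 0 <= t <= t0.
have P01 t : P t -> 0 <= t <= 1.
  by move=> /andP[-> /le_trans]; apply; rewrite ge_min lexx.
have frobZt (t : R) p r (B : 'M[C]_(p, r)) : P t -> frob (t%:C%C *: B) = frob B * t ^+ 1.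
  by move=> /andP[t_ge0 _]; rewrite frobZ normc_real ger0_norm // mulrC expr1.
pose Xt (t : R) := X + t%:C%C *: Y.
have Xt_herm t : (Xt t)^t* = Xt t.
  rewrite /Xt adjD adjZ X_herm Yh; congr (_ + _ *: _); exact: conjc_real.
have Xt_ge t u : P t -> h * frob u ^+ 2 <= qform (Xt t) u.
  move=> Pt; rewrite /Xt qformD.
  have := qform_ge_opp (t%:C%C *: Y) u; rewrite (frobZt _ _ _ _ Pt) expr1.
  have := Xq u.
  have : frob Y * t * frob u ^+ 2 <= h * frob u ^+ 2.
    rewrite ler_wpM2r ?sqr_ge0 //.
    move: Pt => /andP[t_ge0]; rewrite le_min => /andP[_].
    rewrite ler_pdivlMr ?ltr_wpDl ?frob_ge0 // mulrDr mulr1 mulrC => /(le_trans _); apply.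
    by rewrite lerDl.
  by rewrite /h; lra.
have Xt_unit t : P t -> Xt t \in unitmx.
  by move=> Pt; apply: (coercive_unitmx h0) => u; exact: Xt_ge.
have OW : isO P id 0 (fun t => invmx (Xt t)).
  exists (n%:R / h) => t Pt; rewrite expr0 mulr1.
  by apply: coercive_frob_invmx => // u; exact: Xt_ge.
have OdA i : isO P id 1 (fun t => t%:C%C *: dA i).
  by exists (frob (dA i)) => t Pt; rewrite frobZt.
have OD : isO P id 1 (fun t => Xt t - X).
  by exists (frob Y) => t Pt; rewrite /Xt addrC addKr frobZt.
have [c c0 Rem_le] := isO_ge0 P01 (isO_remainder A P01 X_unit Xt_unit OdA OD OW).
exists t0, (c / rho); split; [by [] | by rewrite divr_ge0 // ltW |].
move=> t Pt; pose dQ := residual (fun i => A i + t%:C%C *: dA i) (Xt t) - Q.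
have dQE : dQ = t%:C%C *: H + remainder A X (fun i => t%:C%C *: dA i) (Xt t).
  rewrite /dQ -{1}X_sol.2 -/(residual A X) residual_expansion ?Xt_unit //; congr (_ + _).
  by rewrite /Xt [X + _]addrC addrK lyapunovZ linY scalerDr first_orderZ addrK.
exists dQ; split.
- apply/hermsymmxP; rewrite /dQ adjB residual_adj //; congr (_ - _).
  exact: (hermsymmxP _ Q_hpd.1).
- rewrite dQE scaled_perturbationZD; apply: le_trans (frobD _ _) _; apply: lerD.
    rewrite frobZt // expr1 -[leRHS]mul1r ler_wpM2r //; by case/andP: Pt.
  rewrite -(@ler_pXn2r _ 2) ?nnegrE ?frob_ge0 //; last first.
    by rewrite mulr_ge0 ?sqr_ge0 // divr_ge0 // ltW.
  rewrite frob_scaled_perturbation // big1 ?add0r => [|i _]; last first.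
    by rewrite frob0 mul0r expr0n.
  rewrite ler_pXn2r ?nnegrE ?divr_ge0 ?frob_ge0 ?(ltW rho_gt0) //; last first.
    by rewrite mulr_ge0 ?sqr_ge0 // divr_ge0 // ltW.
  by rewrite mulrAC ler_pM2r ?invr_gt0 // Rem_le.
- split; first by apply: (coercive_hermitian_posdef (Xt_herm t) h0) => u; exact: Xt_ge.
  by rewrite /dQ [RHS]addrC subrK.
Qed.

End Bounds.

(** * Spectral norm and real matrices *)

Section SpectralNorm.
Variable R : realType.
Local Notation frob := (@frobenius_norm R _ _).

(** Transfers the laws of the Frobenius norm to real vectors. *)
Lemma euclidean_norm_frob n (x : 'cV[R]_n) :
  euclidean_norm x = frob (map_mx (fun a : R => a%:C%C) x).
Proof.
congr Num.sqrt; apply: eq_bigr => i _.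
by rewrite big_ord1 mxE normc_sqr /= expr0n addr0.
Qed.

Lemma euclidean_norm_ge0 n (x : 'cV[R]_n) : 0 <= euclidean_norm x.
Proof. exact: sqrtr_ge0. Qed.

Lemma euclidean_norm_sqr n (x : 'cV[R]_n) : euclidean_norm x ^+ 2 = \sum_i x i 0 ^+ 2.
Proof. by rewrite sqr_sqrtr // sumr_ge0 // => i _; exact: sqr_ge0. Qed.

Lemma euclidean_normZ n a (x : 'cV[R]_n) : euclidean_norm (a *: x) = `|a| * euclidean_norm x.
Proof. by rewrite !euclidean_norm_frob map_mxZ frobZ normc_real. Qed.

Lemma euclidean_norm0 n : euclidean_norm (0 : 'cV[R]_n) = 0.
Proof. by rewrite euclidean_norm_frob map_mx0 frob0. Qed.

Lemma euclidean_norm_col_mx p q (x : 'cV[R]_p) (y : 'cV[R]_q) :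
  euclidean_norm (col_mx x y) ^+ 2 = euclidean_norm x ^+ 2 + euclidean_norm y ^+ 2.
Proof.
rewrite !euclidean_norm_sqr big_split_ord; congr (_ + _); apply: eq_bigr => i _ /=.
  by rewrite col_mxEu.
by rewrite col_mxEd.
Qed.

Lemma euclidean_norm_mxcol m (q : 'I_m -> nat) (x : forall i, 'cV[R]_(q i)) :
  euclidean_norm (\mxcol_i x i) ^+ 2 = \sum_i euclidean_norm (x i) ^+ 2.
Proof.
under [RHS]eq_bigr do rewrite euclidean_norm_sqr.
rewrite euclidean_norm_sqr [RHS]sig_big_dep /= [RHS](reindex _ tagnat.sig_bij_on) /=.
by apply: eq_bigr => i _; rewrite mxE.
Qed.

Let mul_le_frob p q (M : 'M[R]_(p, q)) x :
  euclidean_norm (M *m x) <= frob (map_mx (fun a : R => a%:C%C) M) * euclidean_norm x.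
Proof. by rewrite !euclidean_norm_frob map_mxM; exact: frobM. Qed.

(** [sup] is meaningful only on a nonempty bounded set; the Frobenius norm bounds this one. *)
Lemma has_sup_spectral p q (M : 'M[R]_(p, q)) :
  has_sup [set euclidean_norm (M *m x) | x in [set x | euclidean_norm x <= 1]].
Proof.
split; first by exists (euclidean_norm (M *m 0)), 0 => //=; rewrite euclidean_norm0.
exists (frob (map_mx (fun a : R => a%:C%C) M)) => _ /= [x x1 <-].
by apply: le_trans (mul_le_frob _ _) _; rewrite ler_piMr ?frob_ge0.
Qed.

Lemma spectral_norm_ge0 p q (M : 'M[R]_(p, q)) : 0 <= spectral_norm M.
Proof.
apply: (sup_upper_bound (has_sup_spectral M)); exists 0 => /=.
  by rewrite euclidean_norm0.
by rewrite mulmx0 euclidean_norm0.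
Qed.

Lemma spectral_normP p q (M : 'M[R]_(p, q)) x :
  euclidean_norm (M *m x) <= spectral_norm M * euclidean_norm x.
Proof.
have [x0|x0] := eqVneq (euclidean_norm x) 0.
  by rewrite x0 mulr0; apply: le_trans (mul_le_frob _ _) _; rewrite x0 mulr0.
have xgt0 : 0 < euclidean_norm x by rewrite lt_def x0 euclidean_norm_ge0.
rewrite -ler_pdivrMr // mulrC.
apply: (sup_upper_bound (has_sup_spectral M)); exists ((euclidean_norm x)^-1 *: x) => /=.
  by rewrite euclidean_normZ ger0_norm ?invr_ge0 ?(ltW xgt0) // mulVf.
by rewrite -scalemxAr euclidean_normZ ger0_norm ?invr_ge0 // ltW.
Qed.

Lemma spectral_norm_le p q (M : 'M[R]_(p, q)) c : 0 <= c ->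
  (forall x, euclidean_norm (M *m x) <= c * euclidean_norm x) -> spectral_norm M <= c.
Proof.
move=> c0 Mc; apply: ge_sup; first exact: (has_sup_spectral M).1.
by move=> _ /= [x x1 <-]; apply: le_trans (Mc x) _; rewrite ler_piMr.
Qed.

End SpectralNorm.

(** * Real form of complex maps, and vectorization *)

Section Realify.
Variable R : realType.
Local Notation C := R[i].
Local Notation frob := (@frobenius_norm R _ _).

Lemma ImD (x y : C) : complex.Im (x + y) = complex.Im x + complex.Im y.
Proof. by case: x; case: y. Qed.

Lemma Im_sum (I : finType) (F : I -> C) :
  complex.Im (\sum_i F i) = \sum_i complex.Im (F i).
Proof. by elim/big_rec2: _ => // i y1 y2 _ <-; exact: ImD. Qed.

(** A real-linear isometry, under which complex matrices act by the block pattern of [Scmx]. *)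
Definition realify n (v : 'cV[C]_n) : 'cV[R]_(n + n) := col_mx (Remx v) (Immx v).

Lemma euclidean_norm_realify n (v : 'cV[C]_n) : euclidean_norm (realify v) = frob v.
Proof.
apply/eqP; rewrite -(@eqrXn2 _ 2) ?euclidean_norm_ge0 ?frob_ge0 //.
rewrite euclidean_norm_col_mx !euclidean_norm_sqr frob_sqr_col -big_split; apply/eqP.
by apply: eq_bigr => i _; rewrite normc_sqr !mxE.
Qed.

Lemma realifyD n (u v : 'cV[C]_n) : realify (u + v) = realify u + realify v.
Proof.
rewrite /realify add_col_mx; congr col_mx; apply/colP => i; rewrite !mxE.
  exact: ReD.
exact: ImD.
Qed.

Lemma realify0 n : realify (0 : 'cV[C]_n) = 0.
Proof. by rewrite /realify -[RHS]col_mx0; congr col_mx; apply/colP => i; rewrite !mxE. Qed.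

Lemma realify_sum n (I : finType) (F : I -> 'cV[C]_n) :
  realify (\sum_i F i) = \sum_i realify (F i).
Proof. by elim/big_rec2: _ => [|i y1 y2 _ <-]; rewrite ?realify0 ?realifyD. Qed.

Lemma realifyZ n (a : R) (v : 'cV[C]_n) : realify (a%:C%C *: v) = a *: realify v.
Proof.
rewrite /realify scale_col_mx; congr col_mx; apply/colP => i; rewrite !mxE.
  by case: (v _ _) => x y /=; rewrite mul0r subr0.
by case: (v _ _) => x y /=; rewrite mul0r addr0.
Qed.

Lemma realify_surj n (x : 'cV[R]_(n + n)) : exists v, x = realify v.
Proof.
exists (\col_i Complex (usubmx x i 0) (dsubmx x i 0)).
rewrite -[LHS]vsubmxK /realify; congr col_mx; apply/colP => i; by rewrite !mxE.
Qed.

Lemma Re_mulmx p q r (M : 'M[C]_(p, q)) (N : 'M[C]_(q, r)) :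
  Remx (M *m N) = Remx M *m Remx N - Immx M *m Immx N.
Proof.
apply/matrixP => i j; rewrite !mxE Re_sum -sumrB; apply: eq_bigr => k _; rewrite !mxE.
by case: (M i k) => a b; case: (N k j).
Qed.

Lemma Im_mulmx p q r (M : 'M[C]_(p, q)) (N : 'M[C]_(q, r)) :
  Immx (M *m N) = Remx M *m Immx N + Immx M *m Remx N.
Proof.
apply/matrixP => i j; rewrite !mxE Im_sum -big_split; apply: eq_bigr => k _; rewrite !mxE.
by case: (M i k) => a b; case: (N k j).
Qed.

Lemma realify_mulmx p q (M : 'M[C]_(p, q)) v :
  realify (M *m v) = block_mx (Remx M) (- Immx M) (Immx M) (Remx M) *m realify v.
Proof.
rewrite /realify mul_block_col Re_mulmx Im_mulmx mulNmx; congr col_mx.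
by rewrite addrC.
Qed.

Definition entrywise_conj p q (v : 'M[C]_(p, q)) := map_mx (fun z : C => z^*) v.

(** Conjugation flips the sign of the imaginary half; this produces the block pattern of [Umx]. *)
Lemma realify_mulmx_conj p q (M1 M2 : 'M[C]_(p, q)) v :
  realify (M1 *m v + M2 *m entrywise_conj v) =
  block_mx (Remx M1 + Remx M2) (Immx M2 - Immx M1) (Immx M1 + Immx M2) (Remx M1 - Remx M2)
    *m realify v.
Proof.
have reconj : Remx (entrywise_conj v) = Remx v by apply/matrixP => i j; rewrite !mxE; case: (v _ _).
have imconj : Immx (entrywise_conj v) = - Immx v by apply/matrixP => i j; rewrite !mxE; case: (v _ _).
rewrite realifyD !realify_mulmx /realify !mul_block_col add_col_mx reconj imconj.
rewrite !(mulmxDl, mulNmx, mulmxN).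
by congr col_mx; zmod_ring_mx.
Qed.

Lemma frob_vec p q (E : 'M[C]_(p, q)) : frob (vec E) = frob E.
Proof.
apply/eqP; rewrite -(@eqrXn2 _ 2) ?frob_ge0 // frob_sqr_col frob_sqr exchange_big pair_big /=.
rewrite (reindex (@mxtens_unindex q p)) /=; last first.
  by exists (@mxtens_index q p) => i _; rewrite ?mxtens_indexK ?mxtens_unindexK.
by apply/eqP; apply: eq_bigr => k _; rewrite mxE.
Qed.

Lemma vec_surj p q (v : 'cV[C]_(q * p)) : exists E : 'M[C]_(p, q), v = vec E.
Proof.
exists (\matrix_(i, j) v (mxtens_index (j, i)) 0); apply/colP => k.
by rewrite !mxE -surjective_pairing mxtens_unindexK.
Qed.

Lemma vec_inj p q : injective (@vec C p q).
Proof.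
move=> E F /colP EF; apply/matrixP => i j.
by have := EF (mxtens_index (j, i)); rewrite !mxE mxtens_indexK.
Qed.

Lemma vecD p q (E F : 'M[C]_(p, q)) : vec (E + F) = vec E + vec F.
Proof. by apply/colP => k; rewrite !mxE. Qed.

Lemma vec0 p q : vec (0 : 'M[C]_(p, q)) = 0.
Proof. by apply/colP => k; rewrite !mxE. Qed.

Lemma vecZ p q a (E : 'M[C]_(p, q)) : vec (a *: E) = a *: vec E.
Proof. by apply/colP => k; rewrite !mxE. Qed.

Lemma vec_sum p q (I : finType) (F : I -> 'M[C]_(p, q)) : vec (\sum_i F i) = \sum_i vec (F i).
Proof. by elim/big_rec2: _ => [|i y1 y2 _ <-]; rewrite ?vec0 ?vecD. Qed.

(** Accounts for [vec_perm_mx] and for the conjugation in the terms with the adjoint of [dA i]. *)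
Lemma vec_adj n (E : 'M[C]_n) : vec (E^t* ) = vec_perm_mx C n *m entrywise_conj (vec E).
Proof.
have -> : entrywise_conj (vec E) = vec (entrywise_conj E) by apply/colP => k; rewrite !mxE.
by rewrite -vec_trmx; congr vec; apply/matrixP => i j; rewrite !mxE.
Qed.

End Realify.

(** * The condition matrix as first-order response *)

Section ConditionMatrix.
Variables (R : realType) (m n : nat).
Local Notation C := R[i].
Local Notation M := 'M[C]_n.
Local Notation frob := (@frobenius_norm R _ _).
Variables (A : 'I_m -> M) (Q X : M) (rho : R) (eta : 'I_m -> R).
Hypothesis Q_hpd : hermitian_posdef Q.
Hypothesis X_sol : is_hpd_solution A Q X.
Hypothesis rho_gt0 : 0 < rho.
Hypothesis eta_gt0 : forall i, 0 < eta i.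

Lemma Lmx_vec (D : M) :
  Lmx A X *m vec D = vec (lyapunov A X D).
Proof.
rewrite mulmxDl mulmx_suml vecD vec_sum; congr (_ + _).
  by rewrite -{1}[1%:M]trmx1 -vec_mulmx mul1mx mulmx1.
by apply: eq_bigr => i _; rewrite vec_mulmx.
Qed.

Lemma Lmx_unit : Lmx A X \in unitmx.
Proof.
have [k k0 lyap] := lyapunov_bounded_below Q_hpd X_sol.
apply: unitmx_ker0 => v; have [D ->] := vec_surj v; rewrite Lmx_vec -[X in _ = X]vec0.
move=> /(@vec_inj R n n) LD0; suff -> : D = 0 by rewrite vec0.
apply: frob_eq0; apply/eqP; rewrite eq_le frob_ge0 andbT.
by apply: le_trans (lyap D) _; rewrite LD0 frob0 mulr0.
Qed.

Lemma lyapunov_surj (F : M) : exists Z, lyapunov A X Z = F.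
Proof.
have [Z Zeq] := vec_surj (invmx (Lmx A X) *m vec F); exists Z.
by apply: vec_inj; rewrite -Lmx_vec -Zeq mulKVmx // Lmx_unit.
Qed.

Definition condition_matrix :=
  row_mx (rho *: Scmx A X) (\mxrow_(i < m) (eta i *: Umx A X i)).

(** Real coordinates scaled so that the Euclidean norm is that of [scaled_perturbation]; [dQ] comes
    first, as in [condition_matrix]. *)
Definition stack (dA : 'I_m -> M) (dQ : M) :=
  col_mx (realify (vec (rho^-1%:C%C *: dQ)))
    (\mxcol_(i < m) realify (vec ((eta i)^-1%:C%C *: dA i))).

Lemma euclidean_norm_stack dA dQ :
  euclidean_norm (stack dA dQ) = frob (scaled_perturbation eta rho dA dQ).
Proof.
apply/eqP; rewrite -(@eqrXn2 _ 2) ?euclidean_norm_ge0 ?frob_ge0 //.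
rewrite euclidean_norm_col_mx euclidean_norm_mxcol frob_row_mx frob_mxrow addrC.
rewrite euclidean_norm_realify frob_vec; apply/eqP; congr (_ + _).
by apply: eq_bigr => i _; rewrite euclidean_norm_realify frob_vec.
Qed.

(** Here [dQ] is an arbitrary complex matrix; [spectral_le_hermitian] reduces to Hermitian ones. *)
Lemma stack_surj x : exists dA dQ, x = stack dA dQ.
Proof.
have real_unscale (a : R) p (v : 'cV[R]_(p + p)) : 0 < a ->
    exists w, v = realify (a^-1%:C%C *: w).
  move=> a0; have [w ->] := realify_surj v; exists (a%:C%C *: w).
  by rewrite scalerA -rmorphM mulVf ?gt_eqF // rmorph1 scale1r.
have dA i : {E : M | submxcol (dsubmx x) i = realify (vec ((eta i)^-1%:C%C *: E))}.
  apply: cid.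
  have [w ->] := real_unscale _ _ (submxcol (dsubmx x) i) (eta_gt0 i).
  by have [E ->] := vec_surj w; exists E; rewrite vecZ.
have [w wE] := real_unscale _ _ (usubmx x) rho_gt0.
have [dQ dQE] := vec_surj w; exists (fun i => sval (dA i)), dQ.
rewrite -[LHS]vsubmxK wE dQE /stack vecZ; congr col_mx.
by rewrite -[LHS]submxcolK; apply: eq_mxcol => i; case: (dA i) => E /= ->.
Qed.

(** The vectorized linearized equation, solved by [Lmx^-1]; the factors [rho] and [eta i] cancel the
    scaling in [stack]. *)
Lemma condition_matrix_stack dA dQ Y : lyapunov A X Y = dQ + first_order A X dA ->
  condition_matrix *m stack dA dQ = realify (vec Y).
Proof.
move=> linY; set Li := invmx (Lmx A X).
have Yeq : vec Y = Li *m (vec dQ +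
    \sum_i (1%:M *t (Bmx A X i)^t* *m vec (dA i) +
            (Bmx A X i)^T *t 1%:M *m (vec_perm_mx C n *m entrywise_conj (vec (dA i))))).
  rewrite -[LHS](mulKmx Lmx_unit) Lmx_vec linY; congr (_ *m _).
  rewrite vecD vec_sum; congr (_ + _); apply: eq_bigr => i _.
  rewrite vecD addrC -vec_adj -{1}[1%:M]trmx1 -!vec_mulmx mulmx1.
  by rewrite mul1mx.
rewrite Yeq mulmxDr mulmx_sumr realifyD realify_sum.
rewrite mul_row_col mul_mxrow_mxcol; congr (_ + _).
  by rewrite vecZ realifyZ -scalemxAr -scalemxAl scalerA mulVf ?gt_eqF // scale1r realify_mulmx.
apply: eq_bigr => i _.
rewrite vecZ realifyZ -scalemxAr -scalemxAl scalerA mulVf ?gt_eqF // scale1r.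
rewrite mulmxDr [X in realify (X + _)]mulmxA [X in realify (_ + X)]mulmxA.
by rewrite [X in realify (_ + X)]mulmxA; exact: esym (realify_mulmx_conj _ _ _).
Qed.

Lemma linearized_le_spectral dA dQ Y : lyapunov A X Y = dQ + first_order A X dA ->
  frob Y <= spectral_norm condition_matrix * frob (scaled_perturbation eta rho dA dQ).
Proof.
move=> linY; rewrite -euclidean_norm_stack -frob_vec -euclidean_norm_realify.
by rewrite -(condition_matrix_stack linY); exact: spectral_normP.
Qed.

Lemma normc_parallelogram (a b : C) :
  Normc.normc (a + b) ^+ 2 + Normc.normc (a - b) ^+ 2 =
  2 * (Normc.normc a ^+ 2 + Normc.normc b ^+ 2).
Proof. by rewrite !normc_sqr; case: a b => a b [c d] /=; ring. Qed.

Lemma frob_parallelogram p q (E F : 'M[C]_(p, q)) :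
  frob (E + F) ^+ 2 + frob (E - F) ^+ 2 = 2 * (frob E ^+ 2 + frob F ^+ 2).
Proof.
rewrite !frob_sqr -!big_split mulr_sumr; apply: eq_bigr => i _ /=.
rewrite -!big_split mulr_sumr; apply: eq_bigr => j _ /=.
by rewrite !mxE normc_parallelogram.
Qed.

Definition hermitian_part (E : M) : M := 2^-1 *: (E + E^t* ).
Definition skew_part (E : M) : M := 2^-1 *: (E - E^t* ).

Lemma hermitian_part_adj E : (hermitian_part E)^t* = hermitian_part E.
Proof. by rewrite /hermitian_part adjZ adjD adjK addrC fmorphV rmorph_nat. Qed.

Lemma skew_part_adj E : (skew_part E)^t* = - skew_part E.
Proof. by rewrite /skew_part adjZ adjB adjK -scalerN opprB fmorphV rmorph_nat. Qed.

Lemma hermitian_partD E F : hermitian_part (E + F) = hermitian_part E + hermitian_part F.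
Proof. by rewrite /hermitian_part adjD addrACA scalerDr. Qed.

Lemma skew_partD E F : skew_part (E + F) = skew_part E + skew_part F.
Proof. by rewrite /skew_part adjD opprD addrACA scalerDr. Qed.

Lemma hermitian_part_id E : E^t* = E -> hermitian_part E = E.
Proof.
move=> Eh; rewrite /hermitian_part Eh scalerDr -scalerDl -[RHS]scale1r; congr (_ *: _).
by rewrite [RHS]splitr mul1r.
Qed.

Lemma skew_part_eq0 E : E^t* = E -> skew_part E = 0.
Proof. by move=> Eh; rewrite /skew_part Eh subrr scaler0. Qed.

Lemma lyapunov_hermitian_part E :
  lyapunov A X (hermitian_part E) = hermitian_part (lyapunov A X E).
Proof. by rewrite /hermitian_part lyapunovZ lyapunovD lyapunov_adj. Qed.

Lemma lyapunov_skew_part E : lyapunov A X (skew_part E) = skew_part (lyapunov A X E).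
Proof. by rewrite /skew_part lyapunovZ lyapunovB lyapunov_adj. Qed.

(** The parallelogram law for [E] and its adjoint, which have equal norms. *)
Lemma frob_parts E : frob (hermitian_part E) ^+ 2 + frob (skew_part E) ^+ 2 = frob E ^+ 2.
Proof.
have n2 : Normc.normc (2^-1 : C) = 2^-1.
  rewrite Normc.normcV; congr _^-1; have -> : (2 : C) = (2 : R)%:C%C by rewrite rmorph_nat.
  by rewrite normc_real ger0_norm.
rewrite !frobZ !exprMn -mulrDr frob_parallelogram frob_adj.
by rewrite n2; field.
Qed.

Lemma frob_i (E : M) : frob ('i *: E) = frob E.
Proof. by rewrite frobZ -complexiE /= expr0n expr1n add0r sqrtr1 mul1r. Qed.

(** [dA] stays with the Hermitian part, since its first-order term is Hermitian; the factor ['i]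
    makes the skew part Hermitian without changing its norm. *)
Lemma frob_scaled_parts dA dQ : frob (scaled_perturbation eta rho dA dQ) ^+ 2 =
  frob (scaled_perturbation eta rho dA (hermitian_part dQ)) ^+ 2 +
  frob (scaled_perturbation eta rho (fun=> 0) ('i *: skew_part dQ)) ^+ 2.
Proof.
have sqrE := frob_scaled_perturbation _ _ eta_gt0 rho_gt0.
rewrite [LHS]sqrE [X in _ = X + _]sqrE [X in _ = _ + X]sqrE.
have -> : \sum_(i < m) (frob (0 : M) / eta i) ^+ 2 = 0.
  by rewrite big1 // => i _; rewrite frob0 mul0r expr0n.
rewrite add0r -addrA; congr (_ + _).
transitivity ((frob (hermitian_part dQ) / rho) ^+ 2 + (frob (skew_part dQ) / rho) ^+ 2).
  have div_sqr (a b c r : R) : b ^+ 2 + c ^+ 2 = a ^+ 2 ->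
      (a / r) ^+ 2 = (b / r) ^+ 2 + (c / r) ^+ 2.
    by move=> bca; rewrite !expr_div_n -bca mulrDl.
  exact: div_sqr (frob_parts dQ).
exact: (congr1 (fun z => _ + (z / rho) ^+ 2) (esym (frob_i (skew_part dQ)))).
Qed.

(** The hypothesis applies to the Hermitian part of [Y] and to ['i] times its skew part, each the
    response to one part of the perturbation; squares add on both sides. *)
Lemma spectral_le_hermitian c : 0 <= c ->
  (forall dA dQ Y, dQ \is hermsymmx -> lyapunov A X Y = dQ + first_order A X dA ->
    frob Y <= c * frob (scaled_perturbation eta rho dA dQ)) ->
  spectral_norm condition_matrix <= c.
Proof.
move=> c0 herm_le; apply: spectral_norm_le => // x.
have [dA [dQ ->]] := stack_surj x.
have [Y linY] := lyapunov_surj (dQ + first_order A X dA).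
rewrite (condition_matrix_stack linY) euclidean_norm_realify frob_vec euclidean_norm_stack.
have Qh_herm : hermitian_part dQ \is hermsymmx by apply/hermsymmxP; rewrite hermitian_part_adj.
have Qs_herm : 'i *: skew_part dQ \is hermsymmx.
  by apply/hermsymmxP; rewrite adjZ skew_part_adj conjCi scaleNr scalerN opprK.
have Yh_le : frob (hermitian_part Y) <=
    c * frob (scaled_perturbation eta rho dA (hermitian_part dQ)).
  apply: herm_le; first exact: Qh_herm.
  rewrite lyapunov_hermitian_part linY hermitian_partD.
  by rewrite (hermitian_part_id (first_order_adj _ _ _)).
have Ys_le : frob ('i *: skew_part Y) <=
    c * frob (scaled_perturbation eta rho (fun=> 0) ('i *: skew_part dQ)).
  apply: herm_le; first exact: Qs_herm.
  rewrite first_order0 addr0 lyapunovZ lyapunov_skew_part linY skew_partD.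
  by rewrite (skew_part_eq0 (first_order_adj _ _ _)) addr0.
have sqr_le (a b b' : R) : 0 <= a -> a <= b * b' -> a ^+ 2 <= b ^+ 2 * b' ^+ 2.
  by move=> a0 ab; rewrite -exprMn ler_pXn2r ?nnegrE // (le_trans a0).
rewrite -(@ler_pXn2r _ 2) ?nnegrE ?mulr_ge0 ?frob_ge0 //.
rewrite exprMn [X in _ <= _ * X]frob_scaled_parts mulrDr -[leLHS]frob_parts.
rewrite -[X in _ + X ^+ 2 <= _]frob_i.
by apply: lerD; [exact: sqr_le (frob_ge0 _) Yh_le | exact: sqr_le (frob_ge0 _) Ys_le].
Qed.

End ConditionMatrix.

Lemma cvg_EFin_bounds (R : realType) (T : Type) (F : set_system T) {FF : Filter F}
    (f : T -> \bar R) (l : R) :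
  (forall e : R, 0 < e -> \forall t \near F, ((l - e)%:E <= f t <= (l + e)%:E)%E) ->
  f @ F --> l%:E.
Proof.
move=> fle B Bl; have /nbhs_ballP[e /= e0 eB] : nbhs l (fun r : R => B r%:E) by exact: Bl.
(* The hypothesis gives non-strict bounds and the ball is open, hence half the radius. *)
have e20 : 0 < e / 2 by rewrite divr_gt0.
apply: filterS (fle _ e20) => t; rewrite /=.
case: (f t) => [r| |] /andP[]; rewrite ?lee_fin ?leye_eq ?leeNy_eq // => h1 h2.
apply: (eB r); rewrite /ball /= ltr_distlC; lra.
Qed.

(** * The limit *)

Section Limit.
Variables (R : realType) (m n : nat).
Local Notation C := R[i].
Local Notation M := 'M[C]_n.
Local Notation frob := (@frobenius_norm R _ _).
Variables (A : 'I_m -> M) (Q X : M) (xi rho : R) (eta : 'I_m -> R).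
Hypothesis Q_hpd : hermitian_posdef Q.
Hypothesis X_sol : is_hpd_solution A Q X.
Hypothesis xi_gt0 : 0 < xi.
Hypothesis rho_gt0 : 0 < rho.
Hypothesis eta_gt0 : forall i, 0 < eta i.

Let s := spectral_norm (condition_matrix A X rho eta).

Lemma worst_relative_change_le : exists d0 k : R, [/\ 0 < d0, 0 <= k & forall delta,
  0 < delta <= d0 ->
  (worst_relative_change A Q X xi rho eta delta <= (xi^-1 * (s + k * delta))%:E)%E].
Proof.
have [||d0 [k [d0_gt0 k0 Xt_le]]] := upper_bound Q_hpd X_sol rho_gt0 eta_gt0
    (spectral_norm_ge0 _ : 0 <= s).
- exact: lyapunov_surj Q_hpd X_sol.
- move=> dA dQ Y _; exact: (linearized_le_spectral Q_hpd X_sol rho_gt0 eta_gt0).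
exists d0, k; split=> // delta /andP[delta0 delta_le].
apply: ge_ereal_sup => _ [dA [dQ [Xt [dQh le_delta sol ->]]]].
rewrite lee_fin invfM mulrCA ler_pM2l ?invr_gt0 // mulrC ler_pdivrMl //.
have := Xt_le delta dA dQ Xt; rewrite (ltW delta0) => /(_ delta_le dQh le_delta sol).
move/le_trans; apply.
by suff -> : delta * (s + k * delta) = s * delta + k * delta ^+ 2 by []; ring.
Qed.

(** Otherwise, by homogeneity, [c] would bound all Hermitian responses, and [spectral_le_hermitian]
    would give [s <= c]. *)
Lemma near_extremal_direction c : c < s -> exists dA H Y, [/\ H \is hermsymmx,
  lyapunov A X Y = H + first_order A X dA, frob (scaled_perturbation eta rho dA H) <= 1 &
  c < frob Y].
Proof.
move=> cs; have [c0|c0] := ltP c 0.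
  (* For negative [c] the zero direction suffices. *)
  exists (fun=> 0), 0, 0; split.
  - by apply/hermsymmxP; rewrite trmx0 map_mx0.
  - by rewrite first_order0 addr0 -[X in lyapunov _ _ X](scale0r (0 : M)) lyapunovZ scale0r.
  - rewrite -(@ler_pXn2r _ 2) ?nnegrE ?frob_ge0 // frob_scaled_perturbation //.
    rewrite big1 => [|i _]; rewrite frob0 mul0r expr0n //.
    by rewrite addr0 expr1n ler01.
  - by rewrite frob0.
apply: contrapT => no_dir; move: cs; apply/negP; rewrite -leNgt.
apply: (spectral_le_hermitian Q_hpd X_sol rho_gt0 eta_gt0 c0) => dA H Y Hh linY.
set sg := frob (scaled_perturbation _ _ _ _).
(* A direction of norm zero cannot be normalized, but its response vanishes. *)
have [sg0|sg0] := eqVneq sg 0.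
  have := linearized_le_spectral Q_hpd X_sol rho_gt0 eta_gt0 linY.
  by rewrite -/sg sg0 !mulr0.
have sg_gt0 : 0 < sg by rewrite lt_def sg0 frob_ge0.
rewrite leNgt; apply/negP => cY; apply: no_dir.
have norm_sg (p q : nat) (E : 'M[C]_(p, q)) : frob (sg^-1%:C%C *: E) = sg^-1 * frob E.
  by rewrite frobZ normc_real gtr0_norm ?invr_gt0.
exists (fun i => sg^-1%:C%C *: dA i), (sg^-1%:C%C *: H), (sg^-1%:C%C *: Y); split.
- by apply/hermsymmxP; rewrite adjZ (hermsymmxP _ Hh); congr (_ *: _); exact: conjc_real.
- by rewrite lyapunovZ linY scalerDr first_orderZ.
- rewrite -[_ *: H]addr0 scaled_perturbationZD -[X in _ + X](_ : 0 = _) ?addr0.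
    by rewrite norm_sg mulVf.
  apply/esym/frob_eq0/eqP; rewrite -sqrf_eq0 frob_scaled_perturbation //.
  by rewrite big1 => [|i _]; rewrite frob0 mul0r expr0n ?addr0.
- by rewrite norm_sg mulrC ltr_pdivlMr.
Qed.

Lemma worst_relative_change_ge e : 0 < e -> exists2 d0 : R, 0 < d0 & forall delta,
  0 < delta <= d0 ->
  ((xi^-1 * (s - e))%:E <= worst_relative_change A Q X xi rho eta delta)%E.
Proof.
move=> e0; have s0 : 0 <= s := spectral_norm_ge0 _.
have [|dA [H [Y [Hh linY le1 sY]]]] := @near_extremal_direction (s - e / 2).
  by rewrite gtrBl divr_gt0.
have [t0 [c [t0_gt0 c0 sol]]] := lower_bound Q_hpd X_sol rho_gt0 eta_gt0 Hh linY le1.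
(* [b * delta <= e / 2] yields [(s - e) * (1 + c * delta) <= s - e / 2]; the added 1 makes [b]
   positive. *)
pose b := s * c + 1; have b0 : 0 < b by rewrite ltr_wpDl ?mulr_ge0.
exists (Num.min t0 (e / 2 / b)); first by rewrite lt_min t0_gt0 !divr_gt0.
move=> delta /andP[delta0]; rewrite le_min => /andP[delta_t0].
rewrite ler_pdivlMr // => delta_e.
have cd1 : 0 < 1 + c * delta by rewrite ltr_pwDl // mulr_ge0 // ltW.
(* Chosen so that [t + c * t ^+ 2 <= t * (1 + c * delta) = delta]. *)
pose t := delta / (1 + c * delta).
have t_gt0 : 0 < t by rewrite divr_gt0.
have t_le : t <= delta.
  by rewrite ler_pdivrMr // mulrDr mulr1 lerDl !mulr_ge0 // ltW.
have [|dQ [dQh le_t solt]] := sol t; first by rewrite ltW // (le_trans t_le).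
apply: (@le_trans _ _ (frob (X + t%:C%C *: Y - X) / (xi * delta))%:E); last first.
  apply: ereal_sup_ubound; exists (fun i => t%:C%C *: dA i), dQ, (X + t%:C%C *: Y); split=> //.
  apply: le_trans le_t _.
  have tE : t * (1 + c * delta) = delta by rewrite mulfVK ?gt_eqF.
  rewrite -[leRHS]tE mulrDr mulr1 lerD2l expr2 mulrCA ler_wpM2l ?(ltW t_gt0) //.
  by rewrite ler_wpM2l.
rewrite lee_fin [X + _]addrC addrK frobZ normc_real gtr0_norm //.
have -> : t * frob Y / (xi * delta) = xi^-1 * (frob Y / (1 + c * delta)).
  by rewrite /t; field; rewrite !gt_eqF.
rewrite ler_pM2l ?invr_gt0 // ler_pdivlMr //; apply: le_trans (ltW sY).
have : 0 <= e * (c * delta) by rewrite !mulr_ge0 // ltW.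
rewrite /b in delta_e; nra.
Qed.

End Limit.

Theorem theorem6p1 (R : realType) (m n : nat) (m_gt0 : (0 < m)%N) (n_gt0 : (0 < n)%N)
    (A : 'I_m -> 'M[R[i]]_n) (Q X : 'M[R[i]]_n)
    (Q_hpd : hermitian_posdef Q) (X_sol : is_hpd_solution A Q X)
    (xi rho : R) (eta : 'I_m -> R)
    (xi_gt0 : 0 < xi) (rho_gt0 : 0 < rho) (eta_gt0 : forall i, 0 < eta i) :
  worst_relative_change A Q X xi rho eta delta @[delta --> 0^'+] -->
    (xi^-1 * spectral_norm
       (row_mx (rho *: Scmx A X) (\mxrow_(i < m) (eta i *: Umx A X i))))%:E.
Proof.
apply: cvg_EFin_bounds => e e0.
(* The factor [xi^-1] turns the tolerance [xi * e] back into [e]. *)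
have exi : 0 < xi * e by rewrite mulr_gt0.
have [d1 [k [d1_gt0 k0 le_worst]]] :=
  worst_relative_change_le Q_hpd X_sol xi_gt0 rho_gt0 eta_gt0.
have [d2 d2_gt0 ge_worst] :=
  worst_relative_change_ge Q_hpd X_sol xi_gt0 rho_gt0 eta_gt0 exi.
(* Makes [k * delta <= xi * e]; the added 1 covers [k = 0]. *)
have d3_gt0 : 0 < xi * e / (k + 1) by rewrite divr_gt0 // ltr_wpDl.
near=> delta.
have delta0 : 0 < delta by near: delta; exact: nbhs_right_gt.
apply/andP; split.
  apply: le_trans (ge_worst delta _); last first.
    by rewrite delta0; near: delta; exact: nbhs_right_le.
  by rewrite lee_fin mulrBr mulKf ?gt_eqF.
apply: le_trans (le_worst delta _) _.
  by rewrite delta0; near: delta; exact: nbhs_right_le.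
rewrite lee_fin mulrDr lerD2l ler_pdivrMl //.
have : delta <= xi * e / (k + 1) by near: delta; exact: nbhs_right_le.
by rewrite ler_pdivlMr ?ltr_wpDl // mulrDr mulr1; lra.
Unshelve. all: by end_near.
Qed.
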